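(* For every integer $n\geq 1$, the global dimension of the monoid algebra $\mathbb C\mathfrak T_n$ of the full transformation monoid $\mathfrak T_n$ is $n-1$.
   Context: $\mathfrak T_n$ is the monoid of all self-maps of $[n]=\{1,\ldots,n\}$ under composition of functions (acting on the left). All modules are left modules. The global dimension of a finite dimensional algebra $A$ is the supremum of the projective dimensions of all $A$-modules. *)

(* Defs.v *)
From HB Require Import structures.
From mathcomp Require Import all_boot all_order all_algebra.
From mathcomp Require Import complex.
From mathcomp Require Import boolp classical_sets constructive_ereal reals ereal.

Set Implicit Arguments.
Unset Strict Implicit.
Unset Printing Implicit Defensive.

Import GRing.Theory.

#[short(type="finMonoidType")]
HB.structure Definition FinMonoid := {M of Monoid M & Finite M}.

(* An alias of {ffun 'I_n -> 'I_n}, so that composition does not compete with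
   the pointwise operations that finite functions inherit from their codomain
   ('I_n.+1 carries the group structure of the integers mod n.+1). *)
Definition full_transf (n : nat) : Type := {ffun 'I_n -> 'I_n}.

Section FullTransformationMonoid.
Variable n : nat.
Implicit Types f g h : full_transf n.

HB.instance Definition _ := Finite.copy (full_transf n) {ffun 'I_n -> 'I_n}.

Definition transf_comp f g : full_transf n := [ffun x : 'I_n => f (g x)].
Definition transf_id : full_transf n := [ffun x : 'I_n => x].

Fact transf_compA : associative transf_comp.
Proof. by move=> f g h; apply/ffunP => x; rewrite !ffunE. Qed.

Fact transf_comp1f : left_id transf_id transf_comp.
Proof. by move=> f; apply/ffunP => x; rewrite !ffunE. Qed.

Fact transf_compf1 : right_id transf_id transf_comp.
Proof. by move=> f; apply/ffunP => x; rewrite !ffunE. Qed.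

HB.instance Definition _ := isMonoid.Build (full_transf n)
  transf_compA transf_comp1f transf_compf1.

End FullTransformationMonoid.

Local Open Scope ring_scope.

(* The element a of the algebra stands for the formal sum \sum_x a x . x; this
   is an alias of {ffun M -> K} because the latter carries the pointwise
   product. *)
Definition monoid_algebra (K : comNzRingType) (M : finMonoidType) : Type :=
  {ffun M -> K}.

Section MonoidAlgebra.
Variables (K : comNzRingType) (M : finMonoidType).
Local Notation KM := (monoid_algebra K M).
Implicit Types (a b c : KM) (k : K).

HB.instance Definition _ := GRing.Lmodule.copy KM {ffun M -> K^o}.

Definition monalg_one : KM := [ffun z : M => (z == 1%g)%:R].

Definition monalg_mul a b : KM :=
  [ffun z : M => \sum_x \sum_(y | (x * y)%g == z) a x * b y].

Fact monalg_mulE a b z :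
  monalg_mul a b z = \sum_x \sum_y a x * b y * (z == (x * y)%g)%:R.
Proof.
rewrite ffunE; apply: eq_bigr => x _; rewrite big_mkcond /=.
by apply: eq_bigr => y _; rewrite eq_sym; case: eqP; rewrite ?mulr1 ?mulr0.
Qed.

Let sum_delta (F : M -> K) (w : M) : \sum_z F z * (z == w)%:R = F w.
Proof.
rewrite (bigD1 w) //= eqxx mulr1 big1 ?addr0 // => z /negPf->.
by rewrite mulr0.
Qed.

Fact monalg_mulA : associative monalg_mul.
Proof.
move=> a b c; apply/ffunP => z.
transitivity (\sum_x \sum_y \sum_w
    a x * b y * c w * (z == (x * y * w)%g)%:R).
- rewrite monalg_mulE; apply: eq_bigr => x _.
  under eq_bigr => t _ do rewrite monalg_mulE mulr_sumr mulr_suml.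
  rewrite exchange_big; apply: eq_bigr => y _.
  under eq_bigr => t _ do rewrite mulr_sumr mulr_suml.
  rewrite exchange_big; apply: eq_bigr => w _ /=.
  rewrite -mulgA -(sum_delta (fun t => a x * b y * c w * (z == (x * t)%g)%:R)).
  by apply: eq_bigr => t _; rewrite !mulrA mulrAC.
- rewrite monalg_mulE [RHS]exchange_big /=.
  under eq_bigr => x _ do rewrite exchange_big /=.
  rewrite exchange_big /=; apply: eq_bigr => w _.
  under [RHS]eq_bigr => t _ do rewrite monalg_mulE !mulr_suml.
  rewrite [RHS]exchange_big /=; apply: eq_bigr => x _.
  under [RHS]eq_bigr => t _ do rewrite !mulr_suml.
  rewrite [RHS]exchange_big /=; apply: eq_bigr => y _.
  rewrite -(sum_delta (fun t => a x * b y * c w * (z == (t * w)%g)%:R)).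
  by apply: eq_bigr => t _; rewrite mulrAC (mulrAC _ (c w)).
Qed.

Fact monalg_mul1r : left_id monalg_one monalg_mul.
Proof.
move=> a; apply/ffunP => z; rewrite monalg_mulE exchange_big /=.
rewrite -[RHS]sum_delta; apply: eq_bigr => y _.
transitivity (a y * (z == (1 * y)%g)%:R); last by rewrite mul1g eq_sym.
rewrite -(sum_delta (fun x => a y * (z == (x * y)%g)%:R)).
by apply: eq_bigr => x _; rewrite ffunE -mulrA mulrC.
Qed.

Fact monalg_mulr1 : right_id monalg_one monalg_mul.
Proof.
move=> a; apply/ffunP => z; rewrite monalg_mulE.
rewrite -[RHS]sum_delta; apply: eq_bigr => x _.
transitivity (a x * (z == (x * 1)%g)%:R); last by rewrite mulg1 eq_sym.
rewrite -(sum_delta (fun y => a x * (z == (x * y)%g)%:R)).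
by apply: eq_bigr => y _; rewrite ffunE mulrAC.
Qed.

Fact monalg_mulDl : left_distributive monalg_mul +%R.
Proof.
move=> a b c; apply/ffunP => z; rewrite !ffunE -big_split /=.
apply: eq_bigr => x _; rewrite -big_split /=.
by apply: eq_bigr => y _; rewrite ffunE mulrDl.
Qed.

Fact monalg_mulDr : right_distributive monalg_mul +%R.
Proof.
move=> a b c; apply/ffunP => z; rewrite !ffunE -big_split /=.
apply: eq_bigr => x _; rewrite -big_split /=.
by apply: eq_bigr => y _; rewrite ffunE mulrDr.
Qed.

Fact monalg_oner_neq0 : monalg_one != 0.
Proof.
by apply/eqP => /ffunP/(_ 1%g)/eqP; rewrite !ffunE eqxx oner_eq0.
Qed.

HB.instance Definition _ := GRing.Zmodule_isNzRing.Build KM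
  monalg_mulA monalg_mul1r monalg_mulr1 monalg_mulDl monalg_mulDr
  monalg_oner_neq0.

Fact monalg_scalerAl k a b : k *: (a * b) = (k *: a) * b.
Proof.
apply/ffunP => z; rewrite !ffunE scaler_sumr; apply: eq_bigr => x _.
by rewrite scaler_sumr; apply: eq_bigr => y _; rewrite ffunE scalerAl.
Qed.

HB.instance Definition _ :=
  GRing.Lmodule_isLalgebra.Build K KM monalg_scalerAl.

Fact monalg_scalerAr k a b : k *: (a * b) = a * (k *: b).
Proof.
apply/ffunP => z; rewrite !ffunE scaler_sumr; apply: eq_bigr => x _.
by rewrite scaler_sumr; apply: eq_bigr => y _; rewrite ffunE scalerAr.
Qed.

HB.instance Definition _ :=
  GRing.Lalgebra_isAlgebra.Build K KM monalg_scalerAr.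

End MonoidAlgebra.

Section HomologicalDimension.
Variable A : nzRingType.

Definition projective (P : lmodType A) : Prop :=
  forall (M N : lmodType A) (g : {linear M -> N}) (f : {linear P -> N}),
    (forall y, exists x, g x = y) ->
    exists h : {linear P -> M}, forall x, g (h x) = f x.

Record proj_resolution (M : lmodType A) := ProjResolution {
  res_obj : nat -> lmodType A;
  res_diff : forall i, {linear res_obj i.+1 -> res_obj i};
  res_aug : {linear res_obj 0 -> M};
  res_projective : forall i, projective (res_obj i);
  res_aug_surj : forall y, exists x, res_aug x = y;
  res_exact0 : forall x, res_aug x = 0 <-> exists y, res_diff 0 y = x;
  res_exactS : forall i x,
    res_diff i x = 0 <-> exists y, res_diff i.+1 y = x
}.

Definition res_length_le (M : lmodType A) (X : proj_resolution M) (d : nat) :=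
  forall i, (d < i)%N -> forall x : res_obj X i, x = 0.

End HomologicalDimension.

Local Open Scope classical_set_scope.

(* Dimensions are valued in the extended reals only to make suprema and infima
   available; the infimum of the empty set is +oo, and the zero module gets
   dimension 0. *)
Definition proj_dim (R : realType) (A : nzRingType) (M : lmodType A) : \bar R :=
  ereal_inf [set (d%:R)%:E | d in
    [set d : nat | exists X : proj_resolution M, res_length_le X d]].

(* Not written as an image of [set: lmodType A], whose universe is too large
   for the type of sets. *)
Definition global_dim (R : realType) (A : nzRingType) : \bar R :=
  ereal_sup [set x | exists M : lmodType A, x = proj_dim R M].

(* Main.v *)
Require Import Defs.
From HB Require Import structures.
From mathcomp Require Import all_boot all_order all_algebra perm complex.
From mathcomp Require Import boolp classical_sets constructive_ereal reals ereal.

(* Write A for the monoid algebra, and say that a module is killed by rank s if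
   every map of rank at most s acts on it as 0.  The injective maps from an
   (s+1)-set to the n-set, with coefficients in M, span a module D on which
   composites that are no longer injective count as 0.

   For M killed by rank s, the elements of D that are invariant under the
   symmetric group of degree s+1 (acting on M through an idempotent of rank s+1)
   map onto the submodule of M generated by the maps of rank s+1, with a kernel
   that is killed by rank s+1.  This invariant part is a summand of D, and D has
   projective dimension at most s: deleting and contracting edges of the
   complete graph on s+1 vertices relates D to the projective modules spanned by
   all maps from an r-set to the n-set.

   When M is killed by rank s and embeds in functions on injective maps from an
   s-set, as all the kernels above do, finite differences show that the cover is
   onto, and merging two points shows that transpositions act by -1 on the image
   of the idempotent, so that the cover is projective.  Iterating, such an M has
   projective dimension at most n-1-s, and descending induction on s gives the
   upper bound n-1.  For s = 0 and M trivial the iteration is the Koszul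
   resolution of the trivial module; its last step does not split, because
   nothing maps from the cover to a module killed by rank s+1. *)

Set Implicit Arguments.
Unset Strict Implicit.
Unset Printing Implicit Defensive.

Import GRing.Theory Num.Theory.
Local Open Scope ring_scope.

(** * Exact sequences of modules *)

Section Kernel.
Variables (A : nzRingType) (M N : lmodType A) (p : {linear M -> N}).

Definition in_ker : {pred M} := fun x => p x == 0.

Fact in_ker_submod_closed : submod_closed in_ker.
Proof.
split=> [|a x y]; rewrite !unfold_in ?linear0 //.
by move=> /eqP px /eqP py; rewrite linearP px py scaler0 addr0.
Qed.

HB.instance Definition _ := GRing.isSubmodClosed.Build A M in_ker
  in_ker_submod_closed.

Definition kerm : Type := {x | x \in in_ker}.
HB.instance Definition _ := SubType.on kerm.
HB.instance Definition _ := [Choice of kerm by <:].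
HB.instance Definition _ := [SubChoice_isSubLmodule of kerm by <:].

Definition kerm_val (x : kerm) : M := val x.

Fact kerm_val_linear : linear kerm_val.
Proof. by move=> a x y; rewrite /kerm_val linearP. Qed.
HB.instance Definition _ := GRing.isLinear.Build A kerm M _ kerm_val
  kerm_val_linear.

Lemma kerm_valP (x : kerm) : p (kerm_val x) = 0.
Proof. by case: x => x px; apply/eqP. Qed.

Lemma kerm_val_inj : injective kerm_val.
Proof. exact: val_inj. Qed.

Lemma kerm_ex x : p x = 0 -> exists y, kerm_val y = x.
Proof.
move=> /eqP px; have kx : x \in in_ker by [].
by exists (Sub x kx : kerm); apply: SubK.
Qed.

End Kernel.
Arguments kerm_val {A M N} p x : simpl never.

Section Cokernel.
Variables (A : nzRingType) (M N : lmodType A) (p : {linear M -> N}).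

Definition in_im : {pred N} := fun y => `[< exists x, p x = y >].

Fact in_im_submod_closed : submod_closed in_im.
Proof.
split=> [|a x y]; first by apply/asboolP; exists 0; rewrite linear0.
move=> /asboolP[u <-] /asboolP[v <-]; apply/asboolP.
by exists (a *: u + v); rewrite linearP.
Qed.

HB.instance Definition _ := GRing.isSubmodClosed.Build A N in_im
  in_im_submod_closed.

Definition cokerm : Type := Quotient.quot in_im.
HB.instance Definition _ := GRing.Zmodule.on cokerm.

Definition cokerm_pi (y : N) : cokerm := \pi_(Quotient.quot in_im)%qT y.

Lemma cokerm_pi_eq x y : (cokerm_pi x = cokerm_pi y) <-> in_im (x - y).
Proof.
by split=> [/eqP|xy]; last apply/eqP; rewrite -Quotient.idealrBE.
Qed.

Fact cokerm_piB : {morph cokerm_pi : x y / x - y}.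
Proof. by move=> x y; rewrite /cokerm_pi !piE. Qed.
HB.instance Definition _ := GRing.isZmodMorphism.Build N cokerm cokerm_pi
  cokerm_piB.

Lemma cokerm_pi_surj z : exists y, cokerm_pi y = z.
Proof. by exists (repr z); rewrite /cokerm_pi reprK. Qed.

(** The quotient is one of additive groups only, so the action goes through a representative;
    [cokerm_scaleE] gives independence of the choice. *)
Definition cokerm_scale a (x : cokerm) : cokerm := cokerm_pi (a *: repr x).

Lemma cokerm_scaleE a x : cokerm_scale a (cokerm_pi x) = cokerm_pi (a *: x).
Proof.
apply/cokerm_pi_eq; rewrite -scalerBr; apply: rpredZ.
by apply/cokerm_pi_eq; rewrite /cokerm_pi reprK.
Qed.

Fact cokerm_scaleA a b x :
  cokerm_scale a (cokerm_scale b x) = cokerm_scale (a * b) x.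
Proof. by case: (cokerm_pi_surj x) => y <-; rewrite !cokerm_scaleE scalerA. Qed.
Fact cokerm_scale1 : left_id 1 cokerm_scale.
Proof.
by move=> x; case: (cokerm_pi_surj x) => y <-; rewrite cokerm_scaleE scale1r.
Qed.
Fact cokerm_scaleDr : right_distributive cokerm_scale +%R.
Proof.
move=> a x y; case: (cokerm_pi_surj x) (cokerm_pi_surj y) => [u <-] [v <-].
by rewrite -raddfD !cokerm_scaleE scalerDr raddfD.
Qed.
Fact cokerm_scaleDl x : {morph cokerm_scale^~ x : a b / a + b}.
Proof.
move=> a b; case: (cokerm_pi_surj x) => y <-.
by rewrite !cokerm_scaleE scalerDl raddfD.
Qed.
HB.instance Definition _ := GRing.Zmodule_isLmodule.Build A cokerm
  cokerm_scaleA cokerm_scale1 cokerm_scaleDr cokerm_scaleDl.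

Fact cokerm_pi_scalable : scalable cokerm_pi.
Proof. by move=> a x; rewrite -cokerm_scaleE. Qed.
HB.instance Definition _ := GRing.isScalable.Build A N cokerm _ cokerm_pi
  cokerm_pi_scalable.

Lemma cokerm_pi_eq0 y : cokerm_pi y = 0 <-> exists x, p x = y.
Proof.
rewrite -(raddf0 cokerm_pi); split=> [/cokerm_pi_eq|yp].
  by rewrite subr0 => /asboolP.
by apply/cokerm_pi_eq; rewrite subr0; apply/asboolP.
Qed.

End Cokernel.

Section Exactness.
Variable A : nzRingType.
Implicit Types M N P Q X Y : lmodType A.

Lemma linear_ex M N (f : M -> N) :
  linear f -> exists h : {linear M -> N}, forall x, h x = f x.
Proof.
move=> lf; pose h : {linear M -> N} :=
  HB.pack f (GRing.isLinear.Build A M N _ f lf).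
by exists h.
Qed.

Definition surjective_map M N (p : M -> N) := forall y, exists x, p x = y.

Record ses M' M M'' (i : {linear M' -> M}) (p : {linear M -> M''}) : Prop := Ses {
  ses_inj : injective i;
  ses_surj : surjective_map p;
  ses_exact : forall x, p x = 0 <-> exists y, i y = x
}.

Lemma ses0 M' M M'' (i : {linear M' -> M}) (p : {linear M -> M''}) :
  ses i p -> forall y, p (i y) = 0.
Proof. by case=> _ _ ip y; apply/ip; exists y. Qed.

Lemma ses_kerm M N (p : {linear M -> N}) :
  surjective_map p -> ses (kerm_val p) p.
Proof.
move=> sp; split=> // [|x]; first exact: kerm_val_inj.
by split=> [/kerm_ex//|[y <-]]; apply: kerm_valP.
Qed.

Lemma linear_lift X M' M (i : {linear M' -> M}) (h : {linear X -> M}) :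
  injective i -> (forall x, exists y, i y = h x) ->
  exists h' : {linear X -> M'}, forall x, i (h' x) = h x.
Proof.
move=> ii /choice[f fE].
have lf : linear f by move=> a x y; apply: ii; rewrite linearP !fE linearP.
by have [h' h'E] := linear_ex lf; exists h' => x; rewrite h'E.
Qed.

Lemma corestr X M N (p : {linear M -> N}) (h : {linear X -> M}) :
  (forall x, p (h x) = 0) ->
  exists h' : {linear X -> kerm p}, forall x, kerm_val p (h' x) = h x.
Proof.
by move=> ph; apply: linear_lift => [|x]; [apply: kerm_val_inj | apply: kerm_ex].
Qed.

Definition retract M N :=
  exists (i : {linear M -> N}) (r : {linear N -> M}), forall x, r (i x) = x.

Lemma retract_bij M N (f : {linear M -> N}) :
  injective f -> surjective_map f -> retract M N /\ retract N M.
Proof.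
move=> fi fs; have [g gE] := linear_lift (h := idfun) fi fs.
split; first by exists f, g => x; apply: fi; rewrite gE.
by exists g, f.
Qed.

Lemma projective_retract P Q : retract P Q -> projective Q -> projective P.
Proof.
move=> [i [r ri]] Qp M N g f gs; have [h hE] := Qp _ _ g (f \o r) gs.
by exists (h \o i) => x /=; rewrite hE /= ri.
Qed.

Lemma projective_split M P (p : {linear M -> P}) :
  projective P -> surjective_map p ->
  exists s : {linear P -> M}, forall x, p (s x) = x.
Proof. by move=> Pp ps; apply: (Pp _ _ p idfun). Qed.

Lemma ses_split M' M M'' (i : {linear M' -> M}) (p : {linear M -> M''}) :
    ses i p -> projective M'' ->
  exists (r : {linear M -> M'}) (s : {linear M'' -> M}),
    (forall x, r (i x) = x) /\ forall x, i (r x) + s (p x) = x.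
Proof.
move=> ip M''p; have [s sE] := projective_split M''p (ses_surj ip).
pose h : {linear M -> M} := idfun \- (s \o p).
have [|r rE] := linear_lift (h := h) (ses_inj ip).
  by move=> x; apply/(ses_exact ip); rewrite linearB /= sE subrr.
exists r, s; split=> x; last by rewrite rE /= subrK.
by apply: (ses_inj ip); rewrite rE /= (ses0 ip) linear0 subr0.
Qed.

Lemma projective_ext M' M M'' (i : {linear M' -> M}) (p : {linear M -> M''}) :
  ses i p -> projective M' -> projective M'' -> projective M.
Proof.
move=> ip M'p M''p X Y g f gs; have [r [s [_ rs]]] := ses_split ip M''p.
have [h1 h1E] := M'p _ _ g (f \o i) gs.
have [h2 h2E] := M''p _ _ g (f \o s) gs.
exists ((h1 \o r) \+ (h2 \o p)) => x /=.
by rewrite linearD /= h1E h2E /= -linearD /= rs.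
Qed.

Lemma projective0 M : (forall x : M, x = 0) -> projective M.
Proof.
move=> M0 X Y g f gs; have [|h hE] := linear_ex (f := fun _ : M => 0 : X).
  by move=> a x y; rewrite scaler0 addr0.
by exists h => x; rewrite hE linear0 (M0 x) linear0.
Qed.

End Exactness.

(** * Modules over a monoid algebra *)

Section LinearSection.
Variables (K : fieldType) (U V : lmodType K) (g : {linear U -> V}).

(** Subspaces that meet the kernel of [g] trivially. A maximal one is a complement of the kernel,
    and inverting [g] on it gives a section. *)
Definition partial_complement (S : set U) : Prop :=
  [/\ S 0, forall a x y, S x -> S y -> S (a *: x + y)
    & forall x, S x -> g x = 0 -> x = 0].

Lemma max_partial_complement : exists S, partial_complement S /\
  forall S', partial_complement S' -> (S `<=` S')%classic -> (S' `<=` S)%classic.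
Proof.
pose T := {S : set U | partial_complement S}.
pose R (s t : T) := `[< (sval s `<=` sval t)%classic >].
have [||s t|C Ctot|[S PS] Smax] := @Zorn T R.
- by move=> t; apply/asboolP.
- move=> r s t /asboolP rs /asboolP st; apply/asboolP.
  exact: subset_trans rs st.
- case: s t => [S PS] [S' PS'] /asboolP/= st /asboolP/= ts.
  by apply: eq_exist; apply/seteqP; split.
(* The union of the chain; the disjunct [x = 0] takes care of the empty chain. *)
- pose W x := x = 0 \/ exists2 s : T, C s & sval s x.
  have PW : partial_complement W.
    split=> [|a x y|x]; first by left.
      move=> [->|[s Cs sx]]; first by rewrite scaler0 add0r.
      move=> [->|[t Ct ty]].
        right; exists s => //; case: (svalP s) => s0 + _.
        exact.
      right; case: (Ctot _ _ Cs Ct) => /asboolP st.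
        by exists t => //; case: (svalP t) => _ tl _; apply: tl => //; apply: st.
      by exists s => //; case: (svalP s) => _ tl _; apply: tl => //; apply: st.
    by move=> [->//|[s _ sx]]; case: (svalP s) => _ _; apply.
  exists (exist _ W PW) => s Cs; apply/asboolP => x sx; right.
  by exists s.
exists S; split=> // S' PS' SS'.
have /(congr1 sval)/= <- // : exist _ S' PS' = exist _ S PS :> T.
by apply: Smax; apply/asboolP.
Qed.

Lemma linear_section :
  surjective_map g -> exists s : {linear V -> U}, forall y, g (s y) = y.
Proof.
move=> gs; have [S [[S0 Sl Sg] Smax]] := max_partial_complement.
have SD x y : S x -> S y -> S (x - y).
  move=> Sx Sy; have := Sl (-1) y x Sy Sx.
  by rewrite scaleN1r addrC.
have Sim v : exists2 x, S x & g x = v.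
  apply: contrapT => nv; have [u uv] := gs v.
  (* If nothing in [S] maps to [v], then adjoining the line through a preimage [u] still gives a
     partial complement, against maximality. *)
  pose S' : set U := fun z => exists x k, S x /\ z = x + k *: u.
  have SS' : (S `<=` S')%classic.
    by move=> x Sx; exists x, 0; rewrite scale0r addr0.
  apply: (nv); exists u => //; apply: (Smax S') => //; last first.
    by exists 0, 1; rewrite scale1r add0r.
  split=> [|a _ _ [x [k [Sx ->]]] [y [l [Sy ->]]]|_ [x [k [Sx ->]]]].
  - exact: SS'.
  - exists (a *: x + y), (a * k + l); split; first exact: Sl.
    by rewrite scalerDr scalerA scalerDl addrACA.
  - rewrite linearD linearZ /= uv => gx.
    have [k0|k0] := eqVneq k 0.
      rewrite k0 scale0r addr0; apply: Sg => //.
      by move: gx; rewrite k0 scale0r addr0.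
    case: nv; exists (- k^-1 *: x).
      by have := Sl (- k^-1) x 0 Sx S0; rewrite addr0.
    apply: (scalerI k0); rewrite linearZ /= scalerA mulrN divff // scaleN1r.
    by apply/eqP; rewrite eq_sym -addr_eq0 addrC gx.
have /choice[s sE] : forall v, exists x, S x /\ g x = v.
  by move=> v; have [x Sx gx] := Sim v; exists x.
have [|h hE] := linear_ex (f := s).
  move=> a x y; apply/eqP; rewrite -subr_eq0; apply/eqP; apply: Sg.
    by apply: SD; [case: (sE (a *: x + y)) | apply: Sl; [case: (sE x) | case: (sE y)]].
  rewrite linearB /= linearP (sE _).2 (sE x).2 (sE y).2.
  by rewrite subrr.
by exists h => v; rewrite hE (sE v).2.
Qed.

End LinearSection.

Section Basis.
Variables (K : comNzRingType) (G : finMonoidType).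
Local Notation A := (monoid_algebra K G).

Definition mbasis (g : G) : A := [ffun h => (h == g)%:R].

Lemma mbasis1 : mbasis 1%g = 1.
Proof. by []. Qed.

Lemma sum_mbasis (a : A) : a = \sum_g a g *: mbasis g.
Proof.
apply/ffunP => h; rewrite sum_ffunE (bigD1 h) //= !ffunE eqxx.
rewrite [_ *: _]mulr1 big1 ?addr0 // => g gh.
by rewrite !ffunE eq_sym (negPf gh) [_ *: _]mulr0.
Qed.

Lemma mbasisM g h : mbasis (g * h)%g = mbasis g * mbasis h.
Proof.
apply/ffunP => z; rewrite [RHS]monalg_mulE ffunE.
rewrite (bigD1 g) //= (bigD1 h) //= !ffunE !eqxx !mul1r !big1 ?addr0 //.
- by move=> x xg; rewrite big1 // => y _; rewrite ffunE (negPf xg) !mul0r.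
- by move=> y yh; rewrite !ffunE (negPf yh) mulr0 mul0r.
Qed.

Lemma alg_scaleE (M : lmodType A) k (a : A) (m : M) :
  (k *: a) *: m = k%:A *: (a *: m).
Proof. by rewrite scalerA -scalerAl mul1r. Qed.

Lemma alg_scaleC (M : lmodType A) k (a : A) (m : M) :
  a *: (k%:A *: m) = k%:A *: (a *: m).
Proof. by rewrite !scalerA -scalerAl -scalerAr mul1r mulr1. Qed.

Lemma alg_scaleA (M : lmodType A) k l (m : M) :
  k%:A *: (l%:A *: m) = (k * l)%:A *: m.
Proof. by rewrite -alg_scaleE scalerA. Qed.

Lemma alg_mulrn (M : lmodType A) (m : M) k : m *+ k = (k%:R : K)%:A *: m.
Proof. by rewrite !scaler_nat. Qed.

Lemma alg_scale_sum (M : lmodType A) (a : A) (m : M) :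
  a *: m = \sum_g (a g)%:A *: (mbasis g *: m).
Proof.
rewrite {1}(sum_mbasis a) scaler_suml.
by apply: eq_bigr => g _; rewrite alg_scaleE.
Qed.

(** The scalars [k%:A] and the monoid elements generate the algebra, so linearity can be tested on
    them separately. *)
Lemma linear_basis (M N : lmodType A) (f : M -> N) :
    {morph f : x y / x + y} ->
    (forall k x, f (k%:A *: x) = k%:A *: f x) ->
    (forall g x, f (mbasis g *: x) = mbasis g *: f x) ->
  linear f.
Proof.
move=> fD fZ fG a x y; rewrite fD; congr (_ + _).
have f0 : f 0 = 0 by apply: (addrI (f 0)); rewrite -fD !addr0.
rewrite !alg_scale_sum (big_morph f fD f0).
by apply: eq_bigr => g _; rewrite fZ fG.
Qed.

End Basis.

(** An alias, so that the structure over [K] does not compete with the one over the monoid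
    algebra. *)
Definition restrict_scalars (K : comNzRingType) (G : finMonoidType)
  (M : lmodType (monoid_algebra K G)) : Type := M.

Section Restriction.
Variables (K : comNzRingType) (G : finMonoidType).
Local Notation A := (monoid_algebra K G).
Variable M : lmodType A.

HB.instance Definition _ := GRing.Zmodule.on (restrict_scalars M).

Definition restrict_scalars_scale (k : K) (m : restrict_scalars M) :
  restrict_scalars M := (k%:A : A) *: (m : M).

Fact restrict_scalars_scaleA a b x :
  restrict_scalars_scale a (restrict_scalars_scale b x) =
  restrict_scalars_scale (a * b) x.
Proof. exact: alg_scaleA. Qed.
Fact restrict_scalars_scale1 : left_id 1 restrict_scalars_scale.
Proof. by move=> x; rewrite /restrict_scalars_scale !scale1r. Qed.
Fact restrict_scalars_scaleDr : right_distributive restrict_scalars_scale +%R.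
Proof. by move=> a x y; rewrite /restrict_scalars_scale scalerDr. Qed.
Fact restrict_scalars_scaleDl x : {morph restrict_scalars_scale^~ x : a b / a + b}.
Proof. by move=> a b; rewrite /restrict_scalars_scale !scalerDl. Qed.
HB.instance Definition _ := GRing.Zmodule_isLmodule.Build K (restrict_scalars M)
  restrict_scalars_scaleA restrict_scalars_scale1
  restrict_scalars_scaleDr restrict_scalars_scaleDl.

End Restriction.

Lemma restrict_scalars_section (K : fieldType) (G : finMonoidType)
    (M N : lmodType (monoid_algebra K G)) (g : {linear M -> N}) :
    surjective_map g ->
  exists s : N -> M, [/\ {morph s : x y / x + y},
    forall k x, s (k%:A *: x) = k%:A *: s x & forall y, g (s y) = y].
Proof.
move=> gs; have [|h hE] := @linear_ex K (restrict_scalars M) (restrict_scalars N) g.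
  by move=> k x y; rewrite [LHS]linearP.
have [|s sE] := linear_section (g := h).
  by move=> y; have [x <-] := gs y; exists x; rewrite hE.
exists s; split=> [x y|k x|y]; [exact: linearD | |].
  exact: (@GRing.linearZZ _ _ _ s k (x : restrict_scalars N)).
by have := hE (s y); rewrite sE => <-.
Qed.

(** * Modules spanned by partial actions, with coefficients *)

Section PartialAction.
Variable G : finMonoidType.

(* Partial actions, i.e., actions on pointed sets. *)
Record pact := Pact {
  pact_sort :> finType;
  act : G -> pact_sort -> option pact_sort;
  act1 : forall x, act 1%g x = Some x;
  actM : forall g h x, act (g * h)%g x = obind (act g) (act h x)
}.

End PartialAction.

Section PushForward.
Variables (X Y : finType) (V : nmodType).

Definition push (phi : X -> option Y) (w : {ffun X -> V}) : {ffun Y -> V} :=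
  [ffun y => \sum_(x | phi x == Some y) w x].

Fact pushD phi : {morph push phi : v w / v + w}.
Proof.
move=> v w; apply/ffunP => y; rewrite !ffunE -big_split /=.
by apply: eq_bigr => x _; rewrite ffunE.
Qed.

Lemma eq_push phi psi : phi =1 psi -> push phi =1 push psi.
Proof.
by move=> e w; apply/ffunP => y; rewrite !ffunE; apply: eq_bigl => x; rewrite e.
Qed.

End PushForward.

Lemma push_comp (X Y Z : finType) (V : nmodType) (phi : X -> option Y)
    (psi : Y -> option Z) (w : {ffun X -> V}) :
  push psi (push phi w) = push (obind psi \o phi) w.
Proof.
apply/ffunP => z; rewrite !ffunE.
under eq_bigr => y _ do rewrite ffunE.
rewrite (exchange_big_dep predT) //= [RHS]big_mkcond /=.
apply: eq_bigr => x _; case: (phi x) => [y|] /=; last first.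
  by rewrite big_pred0 // => y; rewrite andbF.
case: eqP => yz; last first.
  by rewrite big1 // => y' /andP[/eqP y'z /eqP[yy']]; case: yz; rewrite yy'.
rewrite (big_pred1 y) // => y'; apply/andP/eqP => [[_ /eqP[->]]//|->].
by rewrite yz !eqxx.
Qed.

Lemma push_id (X : finType) (V : nmodType) (w : {ffun X -> V}) :
  push Some w = w.
Proof. by apply/ffunP => x; rewrite ffunE (big_pred1 x). Qed.

(** The tensor product over [K] of the span of [X] with the vector space underlying [M]: the monoid
    moves the points of [X] and leaves the coefficients alone, and a point where the action is
    undefined goes to 0. *)
Definition pmod (K : comNzRingType) (G : finMonoidType) (X : pact G)
  (M : lmodType (monoid_algebra K G)) : Type := {ffun X -> M}.

Section PermutationModule.
Variables (K : comNzRingType) (G : finMonoidType) (X : pact G).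
Local Notation A := (monoid_algebra K G).
Variable M : lmodType A.
Local Notation XM := (pmod X M).

HB.instance Definition _ := GRing.Zmodule.copy XM {ffun X -> M}.

Definition pmod_scale (a : A) (w : XM) : XM :=
  [ffun x => \sum_g (a g)%:A *: push (act g) w x].

Fact pmod_scaleA a b w : pmod_scale a (pmod_scale b w) = pmod_scale (a * b) w.
Proof.
apply/ffunP => x; rewrite !ffunE.
transitivity (\sum_g \sum_h (a g * b h)%:A *: push (act (g * h)%g) w x).
  apply: eq_bigr => g _; rewrite ffunE.
  under eq_bigr => y _ do rewrite ffunE.
  rewrite exchange_big scaler_sumr; apply: eq_bigr => h _ /=.
  rewrite -scaler_sumr alg_scaleA; congr (_ *: _).
  by rewrite (eq_push (@actM _ X g h)) -push_comp [RHS]ffunE.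
under [RHS]eq_bigr => z _ do rewrite ffunE scaler_suml scaler_suml.
rewrite [RHS]exchange_big; apply: eq_bigr => g _.
under [RHS]eq_bigr => z _ do rewrite scaler_suml scaler_suml big_mkcond /=.
rewrite [RHS]exchange_big; apply: eq_bigr => h _ /=.
by rewrite -big_mkcond (big_pred1 (g * h)%g) // => z; rewrite eq_sym.
Qed.

Let pmod_scale_basis g w : pmod_scale (mbasis K g) w = push (act g) w.
Proof.
apply/ffunP => x; rewrite [LHS]ffunE (bigD1 g) //= ffunE eqxx !scale1r.
by rewrite big1 ?addr0 // => h hg; rewrite ffunE (negPf hg) !scale0r.
Qed.

Fact pmod_scale1 : left_id 1 pmod_scale.
Proof.
by move=> w; rewrite -mbasis1 pmod_scale_basis (eq_push (@act1 _ X)) push_id.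
Qed.
Fact pmod_scaleDr : right_distributive pmod_scale +%R.
Proof.
move=> a v w; apply/ffunP => x; rewrite !ffunE -big_split /=.
by apply: eq_bigr => g _; rewrite pushD ffunE scalerDr.
Qed.
Fact pmod_scaleDl w : {morph pmod_scale^~ w : a b / a + b}.
Proof.
move=> a b; apply/ffunP => x; rewrite !ffunE -big_split /=.
by apply: eq_bigr => g _; rewrite ffunE !scalerDl.
Qed.
HB.instance Definition _ := GRing.Zmodule_isLmodule.Build A XM
  pmod_scaleA pmod_scale1 pmod_scaleDr pmod_scaleDl.

Lemma pmod_scaleE a (w : XM) x :
  (a *: w) x = \sum_g (a g)%:A *: push (act g) w x.
Proof. exact: ffunE. Qed.

Lemma pmod_basisE g (w : XM) : mbasis K g *: w = push (act g) w.
Proof. exact: pmod_scale_basis. Qed.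

Lemma pmod_constE k (w : XM) x : (k%:A *: w) x = k%:A *: w x.
Proof.
have kE g : (k%:A : A) g = k * (g == 1%g)%:R by rewrite !ffunE.
rewrite pmod_scaleE (bigD1 1%g) //= big1 ?addr0; last first.
  by move=> g g1; rewrite kE (negPf g1) mulr0 !scale0r.
by rewrite (eq_push (@act1 _ X)) push_id kE eqxx mulr1.
Qed.

End PermutationModule.

Section PermutationModuleMaps.
Variables (K : comNzRingType) (G : finMonoidType).
Local Notation A := (monoid_algebra K G).
Implicit Types (X Y : pact G) (M N : lmodType A).

Definition delta X M (x : X) (m : M) : pmod X M :=
  [ffun y => if y == x then m else 0].

Fact delta_is_additive X M (x : X) : {morph @delta X M x : m n / m + n}.
Proof.
by move=> m n; apply/ffunP => y; rewrite !ffunE; case: eqP; rewrite ?addr0.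
Qed.

Lemma delta_const X M (x : X) k (m : M) :
  delta x ((k%:A : A) *: m) = (k%:A : A) *: delta x m.
Proof.
apply/ffunP => y; rewrite pmod_constE !ffunE.
by case: eqP; rewrite ?scaler0.
Qed.

Lemma basis_delta X M g (x : X) (m : M) :
  mbasis K g *: delta x m = if act g x is Some y then delta y m else 0.
Proof.
rewrite pmod_basisE; apply/ffunP => z; rewrite ffunE.
under eq_bigr => y _ do rewrite ffunE.
rewrite -big_mkcondr /=.
case gx: (act g x) => [y|]; last first.
  rewrite big_pred0 ?ffunE // => y; apply/negP => /andP[/eqP + /eqP yx].
  by rewrite yx gx.
rewrite ffunE; case: eqP => [->|zy].
  rewrite (big_pred1 x) // => u; apply/andP/eqP => [[_ /eqP]//|->].
  by rewrite gx !eqxx.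
rewrite big_pred0 // => u; apply/negP => /andP[/eqP + /eqP ux].
by rewrite ux gx => -[yz]; apply: zy.
Qed.

Lemma sum_delta X M (w : pmod X M) : w = \sum_x delta x (w x).
Proof.
apply/ffunP => y; rewrite sum_ffunE (bigD1 y) //= ffunE eqxx big1 ?addr0 //.
by move=> x xy; rewrite ffunE eq_sym (negPf xy).
Qed.

Definition equivariant X Y (phi : X -> option Y) :=
  forall g x, obind phi (act g x) = obind (act g) (phi x).

Lemma push_const X Y M (phi : X -> option Y) k (w : pmod X M) :
  push phi ((k%:A : A) *: w : pmod X M) = (k%:A : A) *: (push phi w : pmod Y M).
Proof.
apply/ffunP => y; rewrite pmod_constE !ffunE scaler_sumr.
by apply: eq_bigr => x _; rewrite pmod_constE.
Qed.

Lemma push_linear X Y M (phi : X -> option Y) :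
  equivariant phi -> linear (push phi : pmod X M -> pmod Y M).
Proof.
move=> phiG; apply: linear_basis => [|k w|g w]; first exact: pushD.
  exact: push_const.
rewrite !pmod_basisE !push_comp; apply: eq_push => x.
exact: phiG.
Qed.

Definition pmod_map X M N (f : M -> N) (w : pmod X M) : pmod X N :=
  [ffun x => f (w x)].

(** Linearity of [f] over [K] suffices, because the monoid acts on [X] only. *)
Lemma pmod_map_linear X M N (f : M -> N) :
    {morph f : x y / x + y} ->
    (forall k x, f ((k%:A : A) *: x) = (k%:A : A) *: f x) ->
  linear (@pmod_map X M N f).
Proof.
move=> fD fZ; apply: linear_basis => [v w|k w|g w].
- by apply/ffunP => x; rewrite !ffunE fD.
- by apply/ffunP => x; rewrite pmod_constE [LHS]ffunE pmod_constE fZ ffunE.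
- rewrite !pmod_basisE; apply/ffunP => x; rewrite !ffunE.
  rewrite (big_morph f fD (erefl (f 0))); last first.
  have f0 : f 0 = 0 by apply: (addrI (f 0)); rewrite -fD !addr0.
  by rewrite f0; apply: eq_bigr => y _; rewrite ffunE.
Qed.

HB.instance Definition _ X M N (f : {linear M -> N}) :=
  GRing.isLinear.Build A (pmod X M) (pmod X N) _ (@pmod_map X M N f)
  (pmod_map_linear (linearD f) (fun k => linearZ_LR f k%:A)).

Definition weighted_sum X M (alpha : X -> A) (w : pmod X M) : M :=
  \sum_x alpha x *: w x.

Lemma weighted_sum_linear X M (alpha : X -> A) :
    (forall g x (m : M), mbasis K g *: (alpha x *: m)
       = if act g x is Some y then alpha y *: m else 0) ->
  linear (@weighted_sum X M alpha).
Proof.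
move=> alphaG; apply: linear_basis => [v w|k w|g w]; rewrite /weighted_sum.
- by rewrite -big_split; apply: eq_bigr => x _; rewrite ffunE scalerDr.
- rewrite scaler_sumr; apply: eq_bigr => x _.
  by rewrite pmod_constE alg_scaleC.
- rewrite pmod_basisE scaler_sumr.
  under eq_bigr => y _ do rewrite ffunE scaler_sumr.
  rewrite (exchange_big_dep predT) //=; apply: eq_bigr => x _.
  rewrite alphaG; case: (act g x) => [y|]; last first.
    by rewrite big_pred0 // => y; rewrite ?andbF.
  by rewrite (big_pred1 y) // => z; rewrite eq_sym /=; apply/eqP/eqP => [[]|->].
Qed.

Lemma weighted_sum_delta X M (alpha : X -> A) x (m : M) :
  weighted_sum alpha (delta x m) = alpha x *: m.
Proof.
rewrite /weighted_sum (bigD1 x) //= ffunE eqxx big1 ?addr0 // => y yx.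
by rewrite ffunE (negPf yx) scaler0.
Qed.

(** * Free modules and syzygies *)

Fact regular_act1 (x : G) : Some (1 * x)%g = Some x.
Proof. by rewrite mul1g. Qed.
Fact regular_actM (g h x : G) :
  Some (g * h * x)%g = obind (fun y => Some (g * y)%g) (Some (h * x)%g).
Proof. by rewrite /= mulgA. Qed.
Definition regular : pact G := Pact regular_act1 regular_actM.

(** The free module on the vector space of [M] maps onto [M] by [g (x) m |-> g m], the counit of
    induction and restriction. *)
Definition counit M : pmod regular M -> M :=
  @weighted_sum regular M (fun g : G => mbasis K g).

Fact counit_linear M : linear (@counit M).
Proof.
by apply: weighted_sum_linear => g x m; rewrite scalerA -mbasisM.
Qed.

HB.instance Definition _ M :=
  GRing.isLinear.Build A (pmod regular M) M _ (@counit M) (@counit_linear M).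

Lemma counit_delta1 M (m : M) : counit (delta (1%g : regular) m) = m.
Proof. by rewrite /counit weighted_sum_delta mbasis1 scale1r. Qed.

Lemma counit_surj M : surjective_map (@counit M).
Proof. by move=> m; exists (delta (1%g : regular) m); apply: counit_delta1. Qed.

Lemma counit_pmod_map M N (f : {linear M -> N}) w :
  counit (pmod_map f w) = f (counit w).
Proof.
rewrite /counit /weighted_sum linear_sum; apply: eq_bigr => g _.
by rewrite ffunE linearZ.
Qed.

(** The syzygy for the free cover [counit]. This cover is functorial, hence so is the syzygy. *)
Definition omega M : lmodType A := kerm (@counit M).

End PermutationModuleMaps.

Section Syzygies.
Variables (K : fieldType) (G : finMonoidType).
Local Notation A := (monoid_algebra K G).
Implicit Types M N P : lmodType A.
Local Notation free M := (pmod (regular G) M).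

(** A lift over [K] on the elements [delta 1 m] is extended to the whole free module by [counit]. *)
Lemma projective_free M : projective (free M).
Proof.
move=> X Y g f gs; have [s [sD sZ sK]] := restrict_scalars_section gs.
pose d m := @delta K G (regular G) M 1%g m.
have [|c cE] := linear_ex (f := @pmod_map K G (regular G) M X (fun m => s (f (d m)))).
  apply: pmod_map_linear => [m n|k m].
    by rewrite /d delta_is_additive linearD sD.
  by rewrite /d delta_const linearZ sZ.
exists (counit (M:=X) \o c) => w /=; rewrite cE /counit /weighted_sum.
rewrite linear_sum {2}(sum_delta w) linear_sum; apply: eq_bigr => x _.
rewrite linearZ /= ffunE sK -linearZ /= basis_delta /=.
by rewrite mulg1.
Qed.

Lemma omega_map M N (f : {linear M -> N}) :
  exists f' : {linear omega M -> omega N},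
    forall x, kerm_val _ (f' x) = pmod_map f (kerm_val _ x).
Proof.
apply: (corestr (h := pmod_map f \o kerm_val (@counit K G M))) => x /=.
by rewrite counit_pmod_map kerm_valP linear0.
Qed.

Lemma retract_omega M N : retract M N -> retract (omega M) (omega N).
Proof.
move=> [i [r ri]]; have [i' i'E] := omega_map i; have [r' r'E] := omega_map r.
exists i', r' => x; apply: kerm_val_inj; rewrite r'E i'E.
by apply/ffunP => g; rewrite !ffunE ri.
Qed.

Section CoefMapExact.
Variables (X : pact G) (M' M M'' : lmodType A).
Variables (i : {linear M' -> M}) (p : {linear M -> M''}).
Hypothesis ip : ses i p.

Lemma ses_pmod_map :
  ses (pmod_map i : {linear pmod X M' -> pmod X M})
      (pmod_map p : {linear pmod X M -> pmod X M''}).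
Proof.
split=> [v w /ffunP vw|w|w].
- by apply/ffunP => x; apply: (ses_inj ip); have := vw x; rewrite !ffunE.
- have /choice[s sE] := ses_surj ip.
  by exists [ffun x => s (w x)]; apply/ffunP => x; rewrite !ffunE sE.
- split=> [/ffunP pw|[v <-]]; last first.
    by apply/ffunP => x; rewrite !ffunE (ses0 ip).
  have /choice[s sE] x : exists y, i y = w x.
    by apply/(ses_exact ip); have := pw x; rewrite !ffunE.
  by exists [ffun x => s x]; apply/ffunP => x; rewrite !ffunE sE.
Qed.

End CoefMapExact.

Lemma ses_omega M' M M'' (i : {linear M' -> M}) (p : {linear M -> M''}) :
  ses i p -> exists (i' : {linear omega M' -> omega M})
                    (p' : {linear omega M -> omega M''}), ses i' p'.
Proof.
move=> ip; have cip := ses_pmod_map (regular G) ip.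
have [i' i'E] := omega_map i; have [p' p'E] := omega_map p.
exists i', p'; split=> [x y xy|y|x].
- apply: kerm_val_inj; apply: (ses_inj cip).
  by have := congr1 (kerm_val _) xy; rewrite !i'E.
- have [w wE] := ses_surj cip (kerm_val _ y).
  have /(ses_exact ip)[m mE] : p (counit w) = 0.
    by rewrite -counit_pmod_map wE kerm_valP.
  (* The lift [w] is corrected by an element coming from [M'], which does not change its image, so
     that it lands in the syzygy. *)
  have [|x xE] := @kerm_ex _ _ _ (@counit K G M)
      (w - pmod_map i (delta (1%g : regular G) m)).
    by rewrite linearB /= counit_pmod_map counit_delta1 mE subrr.
  exists x; apply: kerm_val_inj; rewrite p'E xE linearB (ses0 cip) subr0.
  exact: wE.
- split=> [px|[y <-]]; last first.
    by apply: kerm_val_inj; rewrite p'E i'E (ses0 cip) linear0.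
  have /(ses_exact cip)[u uE] : pmod_map p (kerm_val _ x) = 0.
    by rewrite -p'E px linear0.
  have [|y yE] := @kerm_ex _ _ _ (@counit K G M') u.
    by apply: (ses_inj ip); rewrite -counit_pmod_map uE kerm_valP linear0.
  by exists y; apply: kerm_val_inj; rewrite i'E yE uE.
Qed.

Lemma projective_omega P : projective P -> projective (omega P).
Proof.
move=> Pp; have [r [_ [ri _]]] := ses_split (ses_kerm (@counit_surj K G P)) Pp.
apply: projective_retract (@projective_free P).
by exists (kerm_val _), r.
Qed.

(** The kernel of the composite [free M -> M -> M''] is an extension of [M'] by [omega M], hence
    projective. It has [omega M''] as a retract, because [free M -> free M''] splits. *)
Lemma projective_omega_quotient M' M M''
    (i : {linear M' -> M}) (p : {linear M -> M''}) :
    ses i p -> projective M' -> projective (omega M) ->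
  projective (omega M'').
Proof.
move=> ip M'p oMp; have cip := ses_pmod_map (regular G) ip.
pose q : {linear free M -> M''} := p \o @counit K G M.
have [|a aE] := corestr (p := q) (h := kerm_val (@counit K G M)).
  by move=> x; rewrite /q /= kerm_valP linear0.
have [|b bE] := linear_lift (h := @counit K G M \o kerm_val q) (ses_inj ip).
  by move=> x; apply/(ses_exact ip); apply: (kerm_valP x).
have ab : ses a b.
  split=> [x y xy|m|x].
  - by apply: kerm_val_inj; rewrite -!aE xy.
  - have [|x xE] := @kerm_ex _ _ _ q (delta (1%g : regular G) (i m)).
      by rewrite /q /= counit_delta1 (ses0 ip).
    by exists x; apply: (ses_inj ip); rewrite bE /= xE counit_delta1.
  - split=> [bx|[y <-]].
      have [|y yE] := @kerm_ex _ _ _ (@counit K G M) (kerm_val _ x).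
        by have := bE x; rewrite bx linear0.
      by exists y; apply: kerm_val_inj; rewrite aE.
    by apply: (ses_inj ip); rewrite bE /= aE kerm_valP linear0.
apply: (projective_retract _ (projective_ext ab oMp M'p)).
have [s sE] := projective_split (@projective_free M'') (ses_surj cip).
have [|f fE] := corestr (p := q) (h := s \o kerm_val (@counit K G M'')).
  by move=> x; rewrite /q /= -counit_pmod_map sE kerm_valP.
have [|r rE] := corestr (p := @counit K G M'') (h := pmod_map p \o kerm_val q).
  by move=> x; rewrite /= counit_pmod_map; apply: (kerm_valP x).
by exists f, r => x; apply: kerm_val_inj; rewrite rE /= fE /= sE.
Qed.

(** As in Schanuel's lemma: the kernel of [free P -> P -> M] is an extension of [omega M] by
    [free M'], hence projective, and a section of [free P -> P] makes [M'] a retract of it. *)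
Lemma projective_omega_sub M' P M (i : {linear M' -> P}) (p : {linear P -> M}) :
    ses i p -> projective P -> projective (omega M) -> projective M'.
Proof.
move=> ip Pp oMp; have cip := ses_pmod_map (regular G) ip.
pose q : {linear free P -> M} := p \o @counit K G P.
have [|a aE] := corestr (p := q) (h := pmod_map i).
  by move=> x; rewrite /q /= counit_pmod_map (ses0 ip).
have [|b bE] := corestr (p := @counit K G M) (h := pmod_map p \o kerm_val q).
  by move=> x; rewrite /= counit_pmod_map; apply: (kerm_valP x).
have ab : ses a b.
  split=> [x y xy|m|x].
  - by apply: (ses_inj cip); rewrite -!aE xy.
  - have [w wE] := ses_surj cip (kerm_val _ m).
    have [|x xE] := @kerm_ex _ _ _ q w.
      by rewrite /q /= -counit_pmod_map wE kerm_valP.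
    by exists x; apply: kerm_val_inj; rewrite bE /= xE.
  - split=> [bx|[y <-]].
      have /(ses_exact cip)[y yE] : pmod_map p (kerm_val q x) = 0.
        by have := bE x; rewrite bx linear0.
      by exists y; apply: kerm_val_inj; rewrite aE.
    by apply: kerm_val_inj; rewrite bE /= aE (ses0 cip) linear0.
apply: (projective_retract _ (projective_ext ab (@projective_free M') oMp)).
have [s sE] := projective_split Pp (@counit_surj K G P).
have [|f fE] := corestr (p := q) (h := s \o i).
  by move=> x; rewrite /q /= sE (ses0 ip).
have [|r rE] := linear_lift (h := @counit K G P \o kerm_val q) (ses_inj ip).
  by move=> x; apply/(ses_exact ip); apply: (kerm_valP x).
by exists f, r => x; apply: (ses_inj ip); rewrite rE /= fE /= sE.
Qed.

Fixpoint syzygy d M : lmodType A := if d is d'.+1 then syzygy d' (omega M) else M.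

(** Projective dimension at most [d], tested on the standard syzygy so that no comparison of
    resolutions is needed; [pd_le_resolution] and [resolution_pd_le] make the link with
    resolutions. *)
Definition pd_le d M := projective (syzygy d M).

Lemma pd_le_retract d M N : retract M N -> pd_le d N -> pd_le d M.
Proof.
elim: d M N => [|d IHd] M N MN; first exact: projective_retract.
by apply: IHd; apply: retract_omega.
Qed.

Lemma projective_pd_le d P : projective P -> pd_le d P.
Proof.
by elim: d P => [//|d IHd] P Pp; apply: IHd; apply: projective_omega.
Qed.

Lemma pd_leS d M : pd_le d M -> pd_le d.+1 M.
Proof.
elim: d M => [|d IHd] M; first exact: (@projective_pd_le 1).
exact: IHd.
Qed.

Lemma pd_le_trans c d M : (c <= d)%N -> pd_le c M -> pd_le d M.
Proof. by move=> /subnK <-; elim: (d - c)%N => // e IHe /IHe/pd_leS. Qed.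

Lemma pd_le_ext d M' M M'' (i : {linear M' -> M}) (p : {linear M -> M''}) :
  ses i p -> pd_le d M' -> pd_le d M'' -> pd_le d M.
Proof.
elim: d M' M M'' i p => [|d IHd] M' M M'' i p ip; first exact: projective_ext ip.
by have [i' [p' ip']] := ses_omega ip; apply: IHd ip'.
Qed.

Lemma pd_le_quotient d M' M M'' (i : {linear M' -> M}) (p : {linear M -> M''}) :
  ses i p -> pd_le d M' -> pd_le d.+1 M -> pd_le d.+1 M''.
Proof.
elim: d M' M M'' i p => [|d IHd] M' M M'' i p ip.
  exact: projective_omega_quotient ip.
by have [i' [p' ip']] := ses_omega ip; apply: IHd ip'.
Qed.

Lemma pd_le_sub d M' P M (i : {linear M' -> P}) (p : {linear P -> M}) :
  ses i p -> projective P -> pd_le d.+1 M -> pd_le d M'.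
Proof.
elim: d M' P M i p => [|d IHd] M' P M i p ip Pp.
  exact: projective_omega_sub ip Pp.
have [i' [p' ip']] := ses_omega ip.
exact: IHd ip' (projective_omega Pp).
Qed.

Lemma pd_le_resolution d M :
  pd_le d M -> exists X : proj_resolution M, res_length_le X d.
Proof.
elim: d M => [|d IHd] M Mp.
  (* The zero module, as the kernel of the identity. *)
  pose Z : lmodType A := kerm (idfun : {linear M -> M}).
  have Z0 (z : Z) : z = 0 by apply: kerm_val_inj; rewrite linear0; apply: (kerm_valP z).
  pose obj i : lmodType A := if i is _.+1 then Z else M.
  pose diff i : {linear obj i.+1 -> obj i} := \0.
  unshelve eexists.
    apply: (@ProjResolution _ M obj diff (idfun : {linear M -> M})).
    - by case=> [//|i]; apply: projective0.
    - by move=> y; exists y.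
    - by move=> x; split=> [x0|[y <-]//]; exists 0; apply: (esym x0).
    - by move=> i x; split=> [_|_]; [exists 0; rewrite (Z0 x) | ].
  by case=> // i _ x; apply: Z0.
have [Y Yd] := IHd _ Mp.
(* The free cover of [M] is spliced onto the resolution of its syzygy. *)
pose obj i : lmodType A := if i is i'.+1 then res_obj Y i' else free M.
pose diff i : {linear obj i.+1 -> obj i} :=
  match i with
  | 0 => kerm_val (@counit K G M) \o res_aug Y
  | i'.+1 => res_diff Y i'
  end.
unshelve eexists.
  apply: (@ProjResolution _ M obj diff (@counit K G M)).
  - by case=> [|i]; [apply: projective_free | apply: res_projective].
  - exact: counit_surj.
  - move=> x; split=> [/kerm_ex[y <-]|[y <-]]; last exact: kerm_valP.
    by have [z <-] := res_aug_surj Y y; exists z.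
  - case=> [|i] x; last exact: res_exactS.
    rewrite -res_exact0; split=> [vx|/= ->]; last by rewrite linear0.
    by apply: kerm_val_inj; rewrite linear0.
by case=> // i di x; apply: Yd.
Qed.

(** In length 0 the augmentation is an isomorphism. Otherwise the resolution without its first term
    resolves the kernel of the augmentation, and [pd_le_quotient] shifts the dimension. *)
Lemma resolution_pd_le d M (X : proj_resolution M) :
  res_length_le X d -> pd_le d M.
Proof.
elim: d M X => [|d IHd] M X Xd.
  apply: (@projective_retract _ _ (res_obj X 0)); last exact: res_projective.
  apply: (retract_bij (f := res_aug X) _ _).2; last exact: res_aug_surj.
  apply: raddf_inj => x /res_exact0[y <-].
  by rewrite (Xd 1%N _ y) // linear0.
have Xs : ses (kerm_val (res_aug X)) (res_aug X).
  by apply: ses_kerm; apply: res_aug_surj.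
apply: (pd_le_quotient Xs); last first.
  by apply: projective_pd_le; apply: res_projective.
have [|a aE] := corestr (p := res_aug X) (h := res_diff X 0).
  by move=> x; apply/res_exact0; exists x.
have ax x : a x = 0 <-> res_diff X 0 x = 0.
  rewrite -aE; split=> [->|ax]; rewrite ?linear0 //.
  by apply: kerm_val_inj; rewrite linear0.
unshelve eapply IHd.
  apply: (@ProjResolution _ (kerm (res_aug X)) (fun i => res_obj X i.+1)
    (fun i => res_diff X i.+1) a).
  - by move=> i; apply: res_projective.
  - move=> y; have /res_exact0[x xE] := kerm_valP y.
    by exists x; apply: kerm_val_inj; rewrite aE.
  - by move=> x; rewrite ax; apply: res_exactS.
  - by move=> i x; apply: res_exactS.
by move=> i di x; apply: Xd.
Qed.

End Syzygies.

(** * Colourings *)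

Lemma insub_eqSome (T : eqType) (P : pred T) (S : subEqType P) (f : T) (y : S) :
  (insub f == Some y) = (f == val y).
Proof.
case: insubP => [u _ <-|Pf]; first by apply/eqP/eqP => [[->]|/val_inj->].
by apply/esym/negbTE; apply: contraNneq Pf => ->; apply: valP.
Qed.

Section PushEval.
Variables (X Y : finType) (V : nmodType) (phi : X -> option Y).
Implicit Types (w : {ffun X -> V}).

Lemma push1 w x y : phi x = Some y -> (forall x', phi x' = Some y -> x' = x) ->
  push phi w y = w x.
Proof.
move=> xy xU; rewrite ffunE (big_pred1 x) // => x'.
by apply/eqP/eqP => [/xU|->].
Qed.

Lemma push0 w y : (forall x, phi x <> Some y) -> push phi w y = 0.
Proof. by move=> xy; rewrite ffunE big_pred0 // => x; apply/eqP/xy. Qed.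

End PushEval.

Section Colourings.
Variable n : nat.
Local Notation T := (full_transf n).
Local Notation word r := {ffun 'I_r -> 'I_n}.

Definition postcomp r (g : T) (f : word r) : word r := [ffun i => g (f i)].
Definition precomp r r' (q : 'I_r' -> 'I_r) (f : word r) : word r' :=
  [ffun i => f (q i)].

Lemma transfM (g h : T) z : (g * h)%g z = g (h z).
Proof. exact: ffunE. Qed.

Lemma transf1 z : (1%g : T) z = z.
Proof. exact: ffunE. Qed.

Lemma postcomp1 r (f : word r) : postcomp 1%g f = f.
Proof. by apply/ffunP => i; rewrite ffunE transf1. Qed.

Lemma postcompM r (g h : T) (f : word r) :
  postcomp (g * h)%g f = postcomp g (postcomp h f).
Proof. by apply/ffunP => i; rewrite !ffunE. Qed.

Lemma precomp_postcomp r r' (q : 'I_r' -> 'I_r) g (f : word r) :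
  precomp q (postcomp g f) = postcomp g (precomp q f).
Proof. by apply/ffunP => i; rewrite !ffunE. Qed.

Definition proper_col r (E : seq ('I_r * 'I_r)) (f : word r) :=
  all (fun e => f e.1 != f e.2) E.

Lemma proper_postcomp r (E : seq ('I_r * 'I_r)) g f :
  proper_col E (postcomp g f) -> proper_col E f.
Proof.
move=> /allP Egf; apply/allP => e /Egf; rewrite !ffunE.
by apply: contra_neq => ->.
Qed.

(* The colourings with n colours of the graph with edge set E. *)
Definition colouring r (E : seq ('I_r * 'I_r)) := {f : word r | proper_col E f}.

Section Act.
Variables (r : nat) (E : seq ('I_r * 'I_r)).

Definition colouring_act (g : T) (x : colouring E) : option (colouring E) :=
  insub (postcomp g (val x)).

Fact colouring_act1 x : colouring_act 1%g x = Some x.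
Proof. by rewrite /colouring_act postcomp1 valK. Qed.

Fact colouring_actM g h x :
  colouring_act (g * h)%g x = obind (colouring_act g) (colouring_act h x).
Proof.
rewrite /colouring_act postcompM.
case: (insubP _ (postcomp h _)) => [u _ <- //|Ph] /=.
by rewrite insubN //; apply: contra Ph; apply: proper_postcomp.
Qed.

Definition colp : pact T := Pact colouring_act1 colouring_actM.

Lemma colp_actE g (x y : colp) :
  (act g x == Some y) = (postcomp g (val x) == val y).
Proof. exact: insub_eqSome. Qed.

End Act.

Definition pre r r' E E' (q : 'I_r' -> 'I_r) (x : @colp r E) :
  option (@colp r' E') := insub (precomp q (val x)).
Arguments pre {r r'} E E' q x.

Lemma preE r r' E E' (q : 'I_r' -> 'I_r) (x : @colp r E) (y : @colp r' E') :
  (pre E E' q x == Some y) = (precomp q (val x) == val y).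
Proof. exact: insub_eqSome. Qed.

(** If the final word is proper, then so are the intermediate words on both routes, on one by the
    hypothesis and on the other by [proper_postcomp]; if it is not, both routes are undefined. *)
Lemma pre_equivariant r r' E E' (q : 'I_r' -> 'I_r) :
    (forall f, proper_col E' (precomp q f) -> proper_col E f) ->
  equivariant (pre E E' q).
Proof.
move=> qE g x; rewrite /pre /= /colouring_act.
have [Egx|NEgx] := boolP (proper_col E' (precomp q (postcomp g (val x)))).
  rewrite (insubT (proper_col E) (qE _ Egx)) /=.
  move: (Egx); rewrite precomp_postcomp => /proper_postcomp E'x.
  by rewrite (insubT (proper_col E') E'x) /= /pre.
transitivity (@None (colp E')).
  by case: insubP => [u _ uE|//] /=; rewrite uE insubN.
case: insubP => [v _ vE|//] /=.
by rewrite /colouring_act vE insubN // -precomp_postcomp.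
Qed.

End Colourings.
Arguments pre {n r r'} E E' q x.

Section ColouringModules.
Variables (K : fieldType) (n : nat).
Local Notation T := (full_transf n).
Local Notation A := (monoid_algebra K T).
Local Notation word r := {ffun 'I_r -> 'I_n}.
Implicit Types M : lmodType A.

(** Points beyond [s] go to 0, the default value of [inord]. *)
Definition restrict_ord s (z : 'I_n) : 'I_s.+1 := inord z.

Definition extend s (f : word s.+1) : T := [ffun z => f (restrict_ord s z)].

Lemma extend_postcomp s (g : T) (f : word s.+1) :
  (g * extend f)%g = extend (postcomp g f).
Proof. by apply/ffunP => z; rewrite transfM !ffunE. Qed.

Section Widen.
Variables (s : nat) (sn : (s < n)%N).

Lemma widenK : cancel (widen_ord sn) (restrict_ord s).
Proof. by move=> i; apply: (inord_val i). Qed.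

(** Extending a word to a self-map and restricting back are both equivariant, so the words span a
    summand of the free module, namely the left ideal of an idempotent of rank [s.+1]. *)
Lemma projective_words M : projective (pmod (colp n (r := s.+1) [::]) M).
Proof.
pose phi (x : colp n (r := s.+1) [::]) := Some (extend (val x) : regular T).
pose psi (g : regular T) : option (colp n (r := s.+1) [::]) :=
  insub [ffun i => (g : T) (widen_ord sn i)].
have phiG : equivariant phi.
  move=> g x; rewrite /= /colouring_act insubT //= /phi.
  by rewrite extend_postcomp.
have psiG : equivariant psi.
  move=> g x; rewrite /psi /= !insubT //= /colouring_act insubT //=.
  congr Some; apply: val_inj.
  by apply/ffunP => j; rewrite !ffunE.
have [i iE] := linear_ex (push_linear (M := M) phiG).
have [r rE] := linear_ex (push_linear (M := M) psiG).
apply: projective_retract (@projective_free _ _ M); exists i, r => w.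
rewrite iE rE push_comp -[RHS]push_id; apply: eq_push => x /=.
rewrite /psi -[RHS]valK; congr insub; apply/ffunP => j.
by rewrite !ffunE widenK.
Qed.

End Widen.

(** * Deletion and contraction of an edge *)

Section DeletionContraction.
Variables (s : nat) (a : 'I_s.+1) (b : 'I_s.+2) (E : seq ('I_s.+2 * 'I_s.+2)).

(** Contracts the edge between [lift b a] and [b]: the vertex [b] is removed and identified with
    [a]. *)
Definition merge (x : 'I_s.+2) : 'I_s.+1 := odflt a (unlift b x).
Definition contract := [seq (merge e.1, merge e.2) | e <- E].

Lemma merge_lift i : merge (lift b i) = i.
Proof. by rewrite /merge liftK. Qed.

Lemma proper_contract (f : word s.+1) :
  proper_col E (precomp merge f) = proper_col contract f.
Proof. by rewrite /proper_col all_map; apply: eq_all => e /=; rewrite !ffunE. Qed.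

Lemma precomp_merge_inj : injective (precomp merge : word s.+1 -> word s.+2).
Proof.
move=> f g /ffunP fg; apply/ffunP => i.
by have := fg (lift b i); rewrite !ffunE merge_lift.
Qed.

Lemma merge_precomp (f : word s.+2) :
  f (lift b a) = f b -> precomp merge (precomp (lift b) f) = f.
Proof.
move=> fab; apply/ffunP => i; rewrite !ffunE /merge.
by case: unliftP => [j -> //|->].
Qed.

(** A colouring of [E] either gives both ends of the new edge the same colour, and then comes from
    the contraction, or is proper for the enlarged graph. Equal colours stay equal under the monoid,
    so the first kind spans a submodule. *)
Lemma deletion_contraction M :
  exists (i : {linear pmod (colp n contract) M -> pmod (colp n E) M})
         (p : {linear pmod (colp n E) M -> pmod (colp n ((lift b a, b) :: E)) M}),
    ses i p.
Proof.
pose e := (lift b a, b).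
have iG : equivariant (@pre n _ _ contract E merge).
  by apply: pre_equivariant => f; rewrite proper_contract.
have [i iE] := linear_ex (push_linear (M := M) iG).
have pG : equivariant (@pre n _ _ E (e :: E) id).
  apply: pre_equivariant => f /andP[_].
  by congr (is_true (all _ _)); apply/funext => e'; rewrite !ffunE.
have [p pE] := linear_ex (push_linear (M := M) pG).
have preid (x : colp n E) (y : colp n (e :: E)) :
    (pre E (e :: E) id x == Some y) = (val x == val y).
  by rewrite preE; congr (_ == _); apply/ffunP => j; rewrite ffunE.
have mergeP (x : colp n contract) : proper_col E (precomp merge (val x)).
  by rewrite proper_contract (valP x).
pose im (x : colp n contract) : colp n E := Sub _ (mergeP x).
have iEim w x : i w (im x) = w x.
  rewrite iE; apply: push1 => [|x' /eqP].
    by apply/eqP; rewrite preE SubK.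
  by rewrite preE SubK => /eqP/precomp_merge_inj/val_inj.
have valE (y : colp n (e :: E)) : proper_col E (val y).
  by have /andP[] := valP y.
pose sub (y : colp n (e :: E)) : colp n E := Sub _ (valE y).
have pEsub w y : p w y = w (sub y).
  rewrite pE; apply: push1 => [|x' /eqP].
    by apply/eqP; rewrite preid SubK.
  by rewrite preid => /eqP x'y; apply: val_inj; rewrite SubK.
have colE (x : colp n E) :
    (exists y, x = im y) \/ (exists y, x = sub y).
  have [xab|xab] := eqVneq (val x (lift b a)) (val x b); [left|right].
    have Cx : proper_col contract (precomp (lift b) (val x)).
      by rewrite -proper_contract merge_precomp // (valP x).
    exists (Sub _ Cx); apply: val_inj; rewrite SubK.
    by rewrite [val (Sub _ _)]SubK merge_precomp.
  have ex : proper_col (e :: E) (val x) by apply/andP; split => //; apply: (valP x).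
  by exists (Sub _ ex); apply: val_inj; rewrite !SubK.
have i_sub w y : i w (sub y) = 0.
  rewrite iE; apply: push0 => x /eqP; rewrite preE SubK => /eqP xy.
  have := valP y; rewrite /proper_col /= -xy !ffunE => /andP[/negP nab _]; case: nab.
  by rewrite /e /= merge_lift /merge unlift_none.
exists i, p; split=> [v w /ffunP vw|w|w].
- by apply/ffunP => x; rewrite -!iEim vw.
- exists [ffun x => if insub (val x) is Some y then w y else 0].
  by apply/ffunP => y; rewrite pEsub ffunE SubK valK.
- split=> [/ffunP pw|[v <-]]; last first.
    by apply/ffunP => y; rewrite pEsub i_sub ffunE.
  exists [ffun x => w (im x)]; apply/ffunP => x.
  have [[y ->]|[y ->]] := colE x; first by rewrite iEim ffunE.
  by rewrite i_sub -pEsub pw ffunE.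
Qed.

End DeletionContraction.

(** Induction on vertices, then on edges. Without edges the module is projective; a loop leaves no
    colouring; any other edge presents the module as a quotient by the contraction, which has one
    vertex less. *)
Lemma pd_le_colourings M s (E : seq ('I_s.+1 * 'I_s.+1)) :
  (s < n)%N -> pd_le s (pmod (colp n E) M).
Proof.
elim: s E => [|s IHs] E; elim: E => [|[a b] E IHE] sn.
- exact: projective_words.
- apply: projective0 => w; apply/ffunP => -[f Ef]; exfalso.
  by move: Ef; rewrite /proper_col /= (ord1 a) (ord1 b) eqxx.
- by apply: projective_pd_le; apply: projective_words.
- case: (unliftP b a) => [a' ->|ab]; last first.
    apply: projective_pd_le.
    apply: projective0 => w; apply/ffunP => -[f Ef]; exfalso.
    by move: Ef; rewrite /proper_col /= ab eqxx.
  have [i [p ip]] := deletion_contraction a' b E M.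
  by apply: (pd_le_quotient ip); [apply: IHs; apply: ltnW | apply: IHE].
Qed.

End ColouringModules.

(** * The cover of a module killed by maps of small rank *)

Lemma alg_mulrn_eq0 (K : numFieldType) (G : finMonoidType)
    (M : lmodType (monoid_algebra K G)) (m : M) k :
  (0 < k)%N -> m *+ k = 0 -> m = 0.
Proof.
move=> k0; rewrite alg_mulrn => /(congr1 ( *:%R ((k%:R : K)^-1%:A))).
by rewrite scaler0 alg_scaleA mulVf ?pnatr_eq0 -?lt0n // !scale1r.
Qed.

Lemma alg_eq_opp (K : numFieldType) (G : finMonoidType)
    (M : lmodType (monoid_algebra K G)) (m : M) :
  m = - m -> m = 0.
Proof.
move=> mN; apply: (@alg_mulrn_eq0 _ _ _ m 2) => //.
by rewrite mulr2n {1}mN addNr.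
Qed.

Section Rank.
Variable n : nat.
Local Notation T := (full_transf n).
Local Notation word r := {ffun 'I_r -> 'I_n}.

Definition complete r : seq ('I_r * 'I_r) :=
  [seq e <- enum {: 'I_r * 'I_r} | e.1 != e.2].

Lemma properP r (f : word r) : reflect (injective f) (proper_col (complete r) f).
Proof.
apply: (iffP allP) => [fE i j fij|fi e]; last first.
  by rewrite mem_filter => /andP[+ _]; apply: contra_neq; apply: fi.
apply/eqP; apply: contraT => ij; have := fE (i, j).
by rewrite mem_filter /= ij mem_enum fij eqxx => /(_ isT).
Qed.

Definition injword r := colp n (complete r).

Lemma injword_inj r (x : injword r) : injective (val x).
Proof. exact/properP/(valP x). Qed.

Lemma injword_ex r (f : word r) : injective f -> exists x : injword r, val x = f.
Proof. by move=> /properP fP; exists (Sub f fP : injword r); rewrite SubK. Qed.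

Lemma card_injword r (x : injword r) : #|codom (val x)| = r.
Proof. by rewrite card_codom ?card_ord //; apply: injword_inj. Qed.

Definition rank (g : T) : nat := #|codom (g : {ffun 'I_n -> 'I_n})|.

Lemma rank_le (S : {pred 'I_n}) (g : T) : (forall z, g z \in S) -> (rank g <= #|S|)%N.
Proof. by move=> gS; apply/subset_leq_card/fintype.subsetP => _ /codomP[z ->]. Qed.

Lemma card_codom_le r (f : word r) : (#|codom f| <= r)%N.
Proof. by rewrite (leq_trans (card_size _)) // size_codom card_ord. Qed.

Lemma rank_extend s (f : word s.+1) : (rank (extend f) <= #|codom f|)%N.
Proof. by apply: rank_le => z; rewrite ffunE codom_f. Qed.

Lemma rank_extend_noninj s (f : word s.+1) :
  ~ injective f -> (rank (extend f) <= s)%N.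
Proof.
move=> fi; apply: leq_trans (rank_extend f) _.
have := card_codom_le f; rewrite leq_eqVlt => /orP[/eqP fs|//].
case: fi; apply/injectiveP; rewrite /injectiveb /dinjectiveb.
by apply/card_uniqP; rewrite size_codom card_ord -[RHS]fs.
Qed.

Lemma rank_factor s (sn : (s < n)%N) (g : T) : (rank g <= s.+1)%N ->
  exists (f : word s.+1) (q : T), g = (extend f * q)%g.
Proof.
move=> gs; pose l := enum (mem (codom (g : {ffun 'I_n -> 'I_n}))).
have lg z : g z \in l by rewrite mem_enum codom_f.
have ls z : (index (g z) l < s.+1)%N.
  by rewrite (leq_trans _ gs) // /rank cardE index_mem.
(* [g] factors through an enumeration of its image; the default letter pads it when the rank is
   below [s.+1]. *)
exists [ffun i : 'I_s.+1 => nth (widen_ord sn ord0) l i].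
exists [ffun z => widen_ord sn (Ordinal (ls z))].
apply/ffunP => z; rewrite transfM !ffunE widenK.
by rewrite nth_index.
Qed.

End Rank.

(** * The symmetrised cover *)

Section Cover.
Variables (K : numFieldType) (n s : nat) (sn : (s < n)%N).
Local Notation T := (full_transf n).
Local Notation A := (monoid_algebra K T).
Local Notation word r := {ffun 'I_r -> 'I_n}.
Local Notation D r M := (pmod (injword n r) M).
Variable M : lmodType A.

(** The self-maps of the first [s.+1] points, embedded as [e T e] for the idempotent [e = endo id]
    of rank [s.+1]. Through it the symmetric group acts on [e M]. *)
Definition endo (q : 'I_s.+1 -> 'I_s.+1) : T :=
  extend [ffun i => widen_ord sn (q i)].

Lemma endoM q q' : (endo q * endo q')%g = endo (q \o q').
Proof. by apply/ffunP => z; rewrite transfM !ffunE widenK. Qed.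

Lemma extend_endo (f : word s.+1) q : (extend f * endo q)%g = extend (precomp q f).
Proof. by apply/ffunP => z; rewrite transfM !ffunE widenK. Qed.

Fact permx_subproof (sg : 'S_s.+1) (x : injword n s.+1) :
  proper_col (complete s.+1) (precomp sg (val x)).
Proof.
apply/properP => i j; rewrite !ffunE => /injword_inj.
exact: perm_inj.
Qed.

Definition permx (sg : 'S_s.+1) (x : injword n s.+1) : injword n s.+1 :=
  Sub (precomp sg (val x)) (permx_subproof sg x).

Lemma permxE sg x i : val (permx sg x) i = val x (sg i).
Proof. by rewrite SubK ffunE. Qed.

Lemma val_permx sg x : val (permx sg x) = precomp sg (val x).
Proof. by rewrite SubK. Qed.

Lemma permxM sg tau x : permx sg (permx tau x) = permx (sg * tau)%g x.
Proof. by apply/val_inj/ffunP => i; rewrite !permxE permM. Qed.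

Lemma permx1 x : permx 1%g x = x.
Proof. by apply/val_inj/ffunP => i; rewrite permxE perm1. Qed.

Lemma permx_inj sg : injective (permx sg).
Proof.
by move=> x y /(congr1 (permx sg^-1%g)); rewrite !permxM mulVg !permx1.
Qed.

Lemma extend_permx sg x :
  extend (val (permx sg x)) = (extend (val x) * endo sg)%g.
Proof. by rewrite val_permx extend_endo. Qed.

Lemma postcomp_permx g sg x y :
  (postcomp g (val (permx sg x)) == val (permx sg y)) =
  (postcomp g (val x) == val y).
Proof.
rewrite !val_permx -precomp_postcomp; apply/eqP/eqP => [/ffunP e|->//].
by apply/ffunP => i; have := e (sg^-1%g i); rewrite !ffunE permKV.
Qed.

(** The identity permutation already forces the values into [e M]. In characteristic 0 the
    invariants stand for the tensor product of [e M] with the span of the injective words over the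
    symmetric group. *)
Definition invariant (w : D s.+1 M) :=
  forall (sg : 'S_s.+1) x, mbasis K (endo sg) *: w (permx sg x) = w x.

Definition avg (w : D s.+1 M) : D s.+1 M :=
  [ffun x => ((#|{: 'S_s.+1}|%:R : K)^-1%:A : A) *:
     (\sum_(sg : 'S_s.+1) mbasis K (endo sg) *: w (permx sg x))].

Fact avg_linear : linear avg.
Proof.
apply: linear_basis => [v w|k w|g w]; apply/ffunP => x.
- rewrite !ffunE -scalerDr -big_split; congr (_ *: _).
  by apply: eq_bigr => sg _; rewrite ffunE scalerDr.
- rewrite pmod_constE [LHS]ffunE [in RHS]ffunE -alg_scaleC; congr (_ *: _).
  rewrite scaler_sumr; apply: eq_bigr => sg _.
  by rewrite pmod_constE alg_scaleC.
- rewrite !pmod_basisE !ffunE.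
  under [RHS]eq_bigr => y _ do rewrite ffunE.
  rewrite -scaler_sumr; congr (_ *: _); rewrite exchange_big.
  apply: eq_bigr => sg _; rewrite ffunE scaler_sumr (reindex_inj (@permx_inj sg)).
  by apply: eq_bigl => y; rewrite !colp_actE postcomp_permx.
Qed.
HB.instance Definition _ := GRing.isLinear.Build A (D s.+1 M) (D s.+1 M) _ avg
  avg_linear.

Lemma avg_invariant w : invariant (avg w).
Proof.
move=> tau x; rewrite !ffunE alg_scaleC; congr (_ *: _).
rewrite scaler_sumr [RHS](reindex_inj (mulIg tau)).
apply: eq_bigr => sg _; rewrite scalerA -mbasisM endoM permxM.
congr (mbasis _ _ *: _); congr (extend _); apply/ffunP => i.
by rewrite !ffunE /= permM.
Qed.

Lemma card_perm_neq0 : (#|{: 'S_s.+1}|%:R : K) != 0.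
Proof. by rewrite pnatr_eq0 -lt0n; apply/card_gt0P; exists 1%g. Qed.

Lemma avg_id w : invariant w -> avg w = w.
Proof.
move=> wI; apply/ffunP => x; rewrite ffunE.
under eq_bigr => sg _ do rewrite wI.
rewrite sumr_const alg_mulrn alg_scaleA mulVf ?card_perm_neq0 //.
by rewrite !scale1r.
Qed.

(** The fixed points of the projector [avg], which are exactly the invariant elements. *)
Definition inv_mod : lmodType A :=
  kerm (avg \- idfun : {linear D s.+1 M -> D s.+1 M}).
Definition inv_val (x : inv_mod) : D s.+1 M := kerm_val _ x.

Fact inv_val_linear : linear inv_val.
Proof. by move=> a x y; rewrite /inv_val linearP. Qed.
HB.instance Definition _ := GRing.isLinear.Build A inv_mod (D s.+1 M) _ inv_val
  inv_val_linear.

Lemma inv_val_inj : injective inv_val.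
Proof. exact: kerm_val_inj. Qed.

Lemma inv_valP x : invariant (inv_val x).
Proof.
have /= /eqP := kerm_valP (p := avg \- idfun) x.
by rewrite subr_eq0 -/(inv_val x) => /eqP <-; apply: avg_invariant.
Qed.

Lemma inv_retract : exists r : {linear D s.+1 M -> inv_mod},
  (forall w, inv_val (r w) = avg w) /\ forall x, r (inv_val x) = x.
Proof.
have [w|r rE] := corestr (p := avg \- idfun) (h := avg).
  by apply/eqP; rewrite /= subr_eq0 avg_id //; apply: avg_invariant.
exists r; split=> [//|x]; apply: inv_val_inj.
by rewrite [LHS]rE /= avg_id //; apply: inv_valP.
Qed.

Definition killed (c : nat) (N : lmodType A) :=
  forall (g : T) (m : N), (rank g <= c)%N -> mbasis K g *: m = 0.

Hypothesis M_killed : killed s M.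

Definition cover_sum : D s.+1 M -> M :=
  @weighted_sum K T (injword n s.+1) M (fun x => mbasis K (extend (val x))).

(** A composite that is no longer injective counts as 0 in [D]; its extension has rank at most [s],
    so it acts as 0 on [M] too. *)
Fact cover_sum_linear : linear cover_sum.
Proof.
apply: weighted_sum_linear => g x m; rewrite scalerA -mbasisM extend_postcomp.
rewrite /act /= /colouring_act; case: insubP => [y _ <- //|/properP gx].
by apply: M_killed; apply: rank_extend_noninj.
Qed.
HB.instance Definition _ := GRing.isLinear.Build A (D s.+1 M) M _ cover_sum
  cover_sum_linear.

Lemma cover_sum_avg w : cover_sum (avg w) = cover_sum w.
Proof.
have sumE (sg : 'S_s.+1) : \sum_x mbasis K (extend (val x)) *:
    (mbasis K (endo sg) *: w (permx sg x)) = cover_sum w.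
  rewrite [RHS](reindex_inj (@permx_inj sg)); apply: eq_bigr => x _.
  by rewrite scalerA -mbasisM -extend_permx.
rewrite {1}/cover_sum /weighted_sum.
under eq_bigr => x _ do rewrite ffunE alg_scaleC scaler_sumr.
rewrite -scaler_sumr exchange_big /=.
under eq_bigr => sg _ do rewrite sumE.
rewrite sumr_const alg_mulrn alg_scaleA mulVf ?card_perm_neq0 //.
by rewrite !scale1r.
Qed.

Definition cover : {linear inv_mod -> M} := cover_sum \o inv_val.

Lemma cover_image g m : (rank g <= s.+1)%N -> exists x, cover x = mbasis K g *: m.
Proof.
move=> gs; have [f [q ->]] := rank_factor sn gs.
have [r [rE _]] := inv_retract; rewrite mbasisM -scalerA.
have [/properP fi|/properP fi] := boolP (proper_col (complete s.+1) f).
  have [x xf] := injword_ex fi.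
  exists (r (delta x (mbasis K q *: m))).
  by rewrite /cover /= rE cover_sum_avg /cover_sum weighted_sum_delta xf.
exists 0; rewrite linear0 M_killed //.
exact: rank_extend_noninj.
Qed.

Lemma codom_permx (x y : injword n s.+1) :
    {subset codom (val y) <= codom (val x)} ->
  exists sg, y = permx sg x.
Proof.
move=> yx; have yxi i : val y i \in codom (val x) by apply/yx/codom_f.
have sgi : injective (fun i => iinv (yxi i)).
  move=> i j /(congr1 (val x)); rewrite !f_iinv.
  exact: injword_inj.
exists (perm sgi); apply/val_inj/ffunP => i.
by rewrite permxE permE f_iinv.
Qed.

(** A word in the support has [s.+1] letters, all in [S], so the support lies in one orbit of the
    symmetric group. By invariance the nonzero terms of the sum all equal the same [m], and a
    multiple of [m] vanishes, so [m = 0]. *)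
Lemma cover_inj_orbit w (S : {pred 'I_n}) : invariant w -> cover_sum w = 0 ->
    (#|S| <= s.+1)%N -> (forall x, w x != 0 -> {subset codom (val x) <= S}) ->
  w = 0.
Proof.
move=> wI w0 Ss wS; apply/ffunP => x0; rewrite [RHS]ffunE.
apply/eqP; apply: contraT => wx0.
have Sx0 : codom (val x0) =i S.
  apply/subset_cardP.
    apply/eqP; rewrite eqn_leq {2}card_injword Ss andbT.
    by apply/subset_leq_card/fintype.subsetP/wS.
  by apply/fintype.subsetP/wS.
pose m := mbasis K (extend (val x0)) *: w x0.
have mE x : w x != 0 -> mbasis K (extend (val x)) *: w x = m.
  move=> /wS xS; have [|sg ->] := @codom_permx x0 x.
    by move=> z /xS; rewrite Sx0.
  by rewrite extend_permx mbasisM -scalerA wI.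
have /eqP := w0; rewrite /cover_sum /weighted_sum (bigID (fun x => w x != 0)) /=.
rewrite addrC big1 ?add0r; last by move=> x /negPn/eqP->; rewrite scaler0.
rewrite (eq_bigr (fun=> m)) // sumr_const => /eqP/alg_mulrn_eq0 m0.
have {}m0 : m = 0 by apply: m0; apply/card_gt0P; exists x0.
case/eqP: wx0; rewrite -(wI 1%g x0) permx1.
(* A left inverse of the word [x0] recovers [w x0] from [m]. *)
pose g : T := [ffun z => widen_ord sn (odflt ord0 [pick i | val x0 i == z])].
suff -> : endo (1%g : 'S_s.+1) = (g * extend (val x0))%g.
  by rewrite mbasisM -scalerA -/m m0 scaler0.
rewrite extend_postcomp; congr extend; apply/ffunP => i; rewrite !ffunE perm1.
by case: pickP => [j /eqP/injword_inj->//|/(_ i)]; rewrite eqxx.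
Qed.

(** The support of [g x] consists of words with letters in the image of [g], which has at most
    [s.+1] points, so [cover_inj_orbit] applies. *)
Lemma killed_cover_ker (x : inv_mod) g :
  cover x = 0 -> (rank g <= s.+1)%N -> mbasis K g *: x = 0.
Proof.
move=> x0 gs; apply: inv_val_inj; rewrite linear0.
apply: (@cover_inj_orbit _ (mem (codom (g : {ffun 'I_n -> 'I_n})))) => //.
- exact: inv_valP.
- have e : cover (mbasis K g *: x) = 0 by rewrite linearZZ x0 scaler0.
  exact: e.
- move=> y; rewrite linearZ /= pmod_basisE ffunE => gy z /codomP[i ->].
  have [u|gN] := pickP (fun u => act g u == Some y); last first.
    by move: gy; rewrite big_pred0 ?eqxx.
  by rewrite colp_actE => /eqP <-; rewrite ffunE; apply: codom_f.
Qed.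

End Cover.

(** * Projectivity of the cover under the sign condition *)

Section SignedCover.
Variables (K : numFieldType) (n s : nat) (sn : (s < n)%N).
Local Notation T := (full_transf n).
Local Notation A := (monoid_algebra K T).
Local Notation word r := {ffun 'I_r -> 'I_n}.
Local Notation D r M := (pmod (injword n r) M).
Variable M : lmodType A.

Definition signed := forall (i j : 'I_s.+1) (m : M), i != j ->
  mbasis K (endo sn (tperm i j)) *: m = - (mbasis K (endo sn id) *: m).

Lemma invariant_id (w : D s.+1 M) x :
  invariant sn w -> mbasis K (endo sn id) *: w x = w x.
Proof.
move=> wI; rewrite -[RHS](wI 1%g) permx1; congr (mbasis _ (extend _) *: _).
by apply/ffunP => i; rewrite !ffunE perm1.
Qed.

Lemma precomp_id r (f : word r) : precomp id f = f.
Proof. by apply/ffunP => i; rewrite ffunE. Qed.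

Let words := colp n (r := s.+1) [::].
Let incl := @pre n _ _ (complete s.+1) [::] id.
Let proj := @pre n _ _ [::] (complete s.+1) id.

Let inclE g z (f : words) :
  (obind (act g) (incl z) == Some f) = (postcomp g (val z) == val f).
Proof. by rewrite /incl /pre insubT //= colp_actE /= precomp_id. Qed.

Let actE g z (f : words) : (obind incl (act g z) == Some f) =
  (postcomp g (val z) == val f) && proper_col (complete s.+1) (val f).
Proof.
rewrite /act /= /colouring_act; case: insubP => [u Pu uE|N] /=.
  by rewrite preE precomp_id uE; case: eqP => // <-; rewrite -uE (valP u).
by apply/esym/negbTE; apply: contra N => /andP[/eqP->].
Qed.

(** If [f i = f j], exchanging the positions [i] and [j] preserves the range of summation, while the
    sign condition and invariance negate each term. *)
Lemma signed_sum0 (w : D s.+1 M) g (f : word s.+1) :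
    signed -> invariant sn w -> ~ injective f ->
  \sum_(z : injword n s.+1 | postcomp g (val z) == f) w z = 0.
Proof.
move=> sgn wI fN; have [i [j [fij /eqP ij]]] : exists i j, f i = f j /\ i <> j.
  apply: contrapT => N; apply: fN => i j fij; apply: contrapT => ij.
  by apply: N; exists i, j.
apply: alg_eq_opp; rewrite {1}(reindex_inj (@permx_inj n s (tperm i j))) -sumrN.
apply: eq_big => [z|z _]; last first.
  rewrite -[in RHS](wI (tperm i j)) sgn // opprK.
  by rewrite invariant_id.
have ft : precomp (tperm i j) f = f.
  by apply/ffunP => k; rewrite ffunE; case: tpermP => // ->.
rewrite val_permx -precomp_postcomp -{1}ft; apply/eqP/eqP => [/ffunP e|->//].
by apply/ffunP => k; have := e (tperm i j k); rewrite !ffunE tpermK.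
Qed.

(* Extension by zero from injective maps to all maps is not equivariant in
   general; the sign condition makes it so. *)
Lemma projective_inv_mod : signed -> projective (inv_mod sn M).
Proof.
move=> sgn; have [r0 [_ r0K]] := inv_retract sn M.
have projG : equivariant proj by apply: pre_equivariant.
have [p pE] := linear_ex (push_linear (M := M) projG).
pose b (x : inv_mod sn M) : pmod words M := push incl (inv_val x).
have [|h hE] := linear_ex (f := b).
  rewrite /b; apply: linear_basis => [x y|k x|g x].
  - by rewrite linearD pushD.
  - by rewrite linearZZ push_const.
  - rewrite linearZZ !pmod_basisE !push_comp; apply/ffunP => f; rewrite !ffunE.
    under eq_bigl => z do rewrite /= actE.
    under [RHS]eq_bigl => z do rewrite /= inclE.
    (* At an injective word the two sums agree; elsewhere the left one is empty and the right one
       cancels by signs. *)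
    have [_|/properP fN] := boolP (proper_col _ _).
      by apply: eq_bigl => z; rewrite andbT.
    rewrite [RHS]signed_sum0 //; last exact: inv_valP.
    by apply: big_pred0 => z; rewrite andbF.
apply: projective_retract (@projective_words K n s sn M).
exists h, (r0 \o p) => x /=; rewrite hE pE -[RHS]r0K; congr (r0 _).
rewrite push_comp -[RHS]push_id; apply: eq_push => z.
apply/eqP; rewrite /= /incl /pre insubT //= /proj preE /=.
by rewrite !precomp_id.
Qed.

Definition iota_word : word s.+1 := [ffun i => widen_ord sn i].

Lemma iota_word_inj : injective iota_word.
Proof. by move=> i j; rewrite !ffunE => /(congr1 val)/= ij; apply: val_inj. Qed.

Definition iota : injword n s.+1 :=
  Sub iota_word (introT (properP _) iota_word_inj).

Lemma iotaE i : val iota i = widen_ord sn i.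
Proof. by rewrite SubK ffunE. Qed.

(** [inv_mod] is a quotient of [D], and every [delta y m] in [D] is the image of [delta iota m]
    under [extend (val y)], whose rank is at most [s.+1]. *)
Lemma inv_mod_hom0 (N : lmodType A) (p : {linear inv_mod sn M -> N}) x :
  killed s.+1 N -> p x = 0.
Proof.
move=> N0; have [r [_ rK]] := inv_retract sn M.
rewrite -(rK x) (sum_delta (inv_val x)) !linear_sum big1 // => y _.
suff -> : delta y (inv_val x y) =
    mbasis K (extend (val y)) *: delta iota (inv_val x y).
  rewrite !linearZZ N0 // (leq_trans (rank_extend _)) //.
  exact: card_codom_le.
rewrite basis_delta; suff -> : act (extend (val y)) iota = Some y by [].
apply/eqP; rewrite colp_actE; apply/eqP/ffunP => i.
by rewrite !ffunE widenK.
Qed.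

End SignedCover.

(** * Finite differences and signs on modules of functions on words *)

Section Embedded.
Variables (K : numFieldType) (n s : nat).
Local Notation T := (full_transf n).
Local Notation A := (monoid_algebra K T).
Local Notation word r := {ffun 'I_r -> 'I_n}.
Local Notation D r M := (pmod (injword n r) M).

Section Alternating.
Variable o : 'I_n.

Definition keep (X : {set 'I_n}) : T := [ffun z => if z \in X then z else o].

Lemma rank_keep X : (rank (keep X) <= #|X|.+1)%N.
Proof.
apply: (@leq_trans #|o |: X|); last by rewrite cardsU1; case: (_ \in _).
apply: rank_le => z; rewrite ffunE !inE.
by case: ifP => zX; rewrite ?zX ?eqxx ?orbT.
Qed.

Lemma keepT : keep [set: 'I_n] = 1%g.
Proof. by apply/ffunP => z; rewrite !ffunE inE. Qed.

(** A finite difference in the letters of [Y]; words too short to use all of these letters are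
    annihilated. *)
Definition alt (Y : {set 'I_n}) : A :=
  \sum_(X in powerset Y) (-1) ^+ #|X| *: mbasis K (keep X).

(* On a word of length s, the maps [keep X] and [keep (X :\ z)] agree for any z
   in Y that is not a letter of the word. *)
Lemma alt_word0 (W : lmodType A) (w : D s W) (Y : {set 'I_n}) :
  (s < #|Y|)%N -> alt Y *: w = 0.
Proof.
move=> sY; rewrite (sum_delta w) scaler_sumr big1 // => x _.
have [z zY zx] : exists2 z, z \in Y & z \notin codom (val x).
  apply: contrapT => N; move: sY; rewrite ltnNge -(card_injword x) => /negP; apply.
  apply/subset_leq_card/fintype.subsetP => z zY; apply: contrapT => /negP zx.
  by apply: N; exists z.
(* Adding or removing [z] is a sign-reversing involution on the subsets of [Y]. *)
pose t (X : {set 'I_n}) := if z \in X then X :\ z else z |: X.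
have tK : involutive t.
  move=> X; rewrite /t; have [zX|zX] := boolP (z \in X).
    by rewrite !inE eqxx /= finset.setD1K.
  by rewrite !inE eqxx /= finset.setU1K.
have tx X y : y != z -> (y \in t X) = (y \in X).
  by move=> yz; rewrite /t; case: ifP; rewrite !inE (negPf yz).
have tcard X : (-1) ^+ #|t X| = - (-1) ^+ #|X| :> K.
  rewrite /t; case: ifPn => zX; last by rewrite cardsU1 zX exprS mulN1r.
  by rewrite [in RHS](cardsD1 z) zX exprS mulN1r opprK.
have tY X : (t X \in powerset Y) = (X \in powerset Y).
  rewrite !inE; apply/fintype.subsetP/fintype.subsetP => XY y.
    by have [->//|yz] := eqVneq y z; rewrite -(tx X) //; apply: XY.
  by have [->//|yz] := eqVneq y z; rewrite tx //; apply: XY.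
have tbasis X : mbasis K (keep (t X)) *: delta x (w x) =
    mbasis K (keep X) *: delta x (w x).
  suff xX : postcomp (keep (t X)) (val x) = postcomp (keep X) (val x).
    by rewrite !basis_delta /act /= /colouring_act xX.
  apply/ffunP => i; rewrite !ffunE tx //; apply: contraNneq zx => <-.
  exact: codom_f.
have scaleN k (a : A) (u : D s W) : ((- k) *: a) *: u = - ((k *: a) *: u).
  by rewrite !scaleNr.
rewrite /alt scaler_suml; apply: alg_eq_opp.
rewrite {1}(reindex_inj (inv_inj tK)) -sumrN; apply: eq_big => [X|X _].
  exact: tY.
by rewrite tcard scaleN alg_scaleE tbasis -alg_scaleE.
Qed.

End Alternating.

Variables (M W : lmodType A) (j : {linear M -> D s W}).
Hypothesis j_inj : injective j.

Lemma alt_embedded0 o (Y : {set 'I_n}) (m : M) : (s < #|Y|)%N -> alt o Y *: m = 0.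
Proof. by move=> sY; apply: j_inj; rewrite linearZZ linear0 alt_word0. Qed.

(** While [Y] has more than [s] elements, the vanishing of [alt o Y] writes [keep o Y] on [m] in
    terms of smaller sets. The descent starts at the full set, where [keep] is the identity, and
    stops at sets of size at most [s], where [keep] has rank at most [s.+1]. *)
Lemma embedded_generated (o : 'I_n) (P : M -> Prop) m :
    P 0 -> (forall x y, P x -> P y -> P (x - y)) ->
    (forall g, (rank g <= s.+1)%N -> P (mbasis K g *: m)) ->
  P m.
Proof.
move=> P0 PB Pg.
have PN x : P x -> P (- x) by move=> Px; rewrite -sub0r; apply: PB.
have PD x y : P x -> P y -> P (x + y).
  by move=> Px Py; rewrite -[y]opprK; apply: PB => //; apply: PN.
have Psign k x : P x -> P (((-1) ^+ k : K)%:A *: x).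
  rewrite -signr_odd => Px; case: (odd k); last by rewrite expr0 !scale1r.
  by rewrite expr1 !scaleN1r; apply: PN.
suff Pkeep k (Y : {set 'I_n}) : (#|Y| <= k)%N -> P (mbasis K (keep o Y) *: m).
  by have := Pkeep _ [set: 'I_n] (leqnn _); rewrite keepT mbasis1 scale1r.
elim: k Y => [|k IHk] Y Yk.
  by apply: Pg; apply: leq_trans (rank_keep o Y) _; rewrite ltnS (leq_trans Yk).
have [Ys|sY] := leqP #|Y| s; first by apply: Pg; apply: leq_trans (rank_keep o Y) _.
have := alt_embedded0 o m sY; rewrite /alt scaler_suml (bigD1 Y) ?powersetE //=.
move=> /eqP; rewrite addr_eq0 alg_scaleE => /eqP YE.
rewrite -[_ *: m]scale1r -[1]scale1r -(sqrr_sign K #|Y|) expr2 -alg_scaleA YE.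
apply/Psign/PN; apply: (big_ind P) => // X; rewrite powersetE => /andP[XY XneY].
rewrite alg_scaleE; apply/Psign/IHk; rewrite -ltnS (leq_trans _ Yk) //.
by apply: proper_card; rewrite finset.properEneq XneY.
Qed.

End Embedded.

Section EmbeddedSign.
Variables (K : numFieldType) (n s : nat) (sn : (s < n)%N).
Local Notation T := (full_transf n).
Local Notation A := (monoid_algebra K T).
Local Notation D r M := (pmod (injword n r) M).
Variables (M W : lmodType A) (j : {linear M -> D s W}).
Hypotheses (j_inj : injective j) (M_killed : killed s M).
Variable m : M.

Let e : T := endo sn id.
Let w : D s W := mbasis K e *: j m.
Let E : {pred 'I_n} := mem (codom (widen_ord sn)).

Definition transf_tperm (p q : 'I_n) : T := [ffun z => tperm p q z].

Fact swap_subproof p q (x : injword n s) :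
  proper_col (complete s) (postcomp (transf_tperm p q) (val x)).
Proof. by apply/properP => i k; rewrite !ffunE => /perm_inj/injword_inj. Qed.

Definition swap p q x : injword n s := Sub _ (swap_subproof p q x).

Lemma swapE p q x i : val (swap p q x) i = tperm p q (val x i).
Proof. by rewrite SubK !ffunE. Qed.

Let card_E : #|E| = s.+1.
Proof.
rewrite card_codom ?card_ord // => i k /(congr1 val)/= ik.
exact: val_inj.
Qed.

Let e_E z : e z \in E.
Proof. by rewrite !ffunE codom_f. Qed.

Let killed_e c : (rank (c * e)%g <= s)%N -> mbasis K c *: w = 0.
Proof.
by move=> ce; rewrite scalerA -mbasisM -linearZZ M_killed // linear0.
Qed.

Let w_codom (x : injword n s) : w x != 0 -> {subset codom (val x) <= E}.
Proof.
move=> wx z /codomP[i ->].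
have [u|N] := pickP (fun u => act e u == Some x); last first.
  by move: wx; rewrite /w pmod_basisE ffunE big_pred0 ?eqxx.
by rewrite colp_actE => /eqP <-; rewrite ffunE.
Qed.

(* Merging p into q followed by e has rank s, hence kills m. *)
Let merge_relation p q (x : injword n s) : p \in E -> q \in E -> p != q ->
    {subset codom (val x) <= E} -> p \notin codom (val x) ->
  w x = - w (swap p q x).
Proof.
move=> pE qE pq xE px; apply/eqP; rewrite -addr_eq0; apply/eqP.
pose c : T := [ffun z => if z == p then q else z].
have cE z : c z = if z == p then q else z by rewrite ffunE.
have cardEp : #|[predD1 E & p]| = s.
  by have := card_E; rewrite (cardD1 p) pE => -[].
have ce : (rank (c * e)%g <= s)%N.
  rewrite -[in leqRHS]cardEp; apply: rank_le => z; rewrite transfM cE !inE.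
  by case: ifPn => [_|-> //]; rewrite ?e_E // eq_sym pq.
have xp i : val x i != p by apply: contraNneq px => <-; apply: codom_f.
have /codomP[i0 qx] : q \in codom (val x).
  have xEp : codom (val x) =i [predD1 E & p].
    apply/subset_cardP; first by rewrite cardEp card_injword.
    apply/fintype.subsetP => z zx; rewrite !inE xE // andbT.
    by apply: contraNneq px => <-.
  by rewrite xEp !inE eq_sym pq.
(* The fibre of [c] over [x] is [x] and [swap p q x]: only the letter at the position [i0], where
   [x] has [q], can differ. *)
have : \sum_(y | act c y == Some x) w y = 0.
  have := killed_e ce; rewrite pmod_basisE => /ffunP/(_ x).
  by rewrite [LHS]ffunE => ->; apply: ffunE.
rewrite (bigD1 x) /=; last first.
  rewrite colp_actE; apply/eqP/ffunP => i.
  by rewrite ffunE cE (negPf (xp i)).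
rewrite (bigD1 (swap p q x)) /=; last first.
  apply/andP; split.
    rewrite colp_actE; apply/eqP/ffunP => i; rewrite ffunE swapE cE.
    case: tpermP => [/eqP|->|/eqP/negPf-> //]; last by rewrite eqxx.
    by rewrite (negPf (xp i)).
  apply: contra_neq pq => /(congr1 (fun y : injword n s => val y i0)).
  by rewrite swapE -qx tpermR.
rewrite addrA big1 ?addr0 // => y /andP[/andP[yx yNx] yNsx].
move: yx; rewrite colp_actE => /eqP/ffunP yx.
have yi i : val x i != q -> val y i = val x i.
  by have := yx i; rewrite ffunE cE; case: eqP => [_ ->|//]; rewrite eqxx.
have xi i : i != i0 -> val x i != q.
  by apply: contra_neq => xq; apply: (injword_inj (x := x)); rewrite xq qx.
have := yx i0; rewrite ffunE cE -qx; case: eqP => [yp _|_ yq].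
  case/eqP: yNsx; apply/val_inj/ffunP => i; rewrite swapE.
  have [->|ii0] := eqVneq i i0; first by rewrite yp -qx tpermR.
  by rewrite yi ?xi // tpermD // eq_sym // xi.
case/eqP: yNx; apply/val_inj/ffunP => i.
by have [->|ii0] := eqVneq i i0; [rewrite yq qx | apply/yi/xi].
Qed.

Let swap_codom p q (x : injword n s) : p \in E -> q \in E ->
  {subset codom (val x) <= E} -> {subset codom (val (swap p q x)) <= E}.
Proof.
move=> pE qE xE z /codomP[i ->]; rewrite swapE.
by case: tpermP => // _ _; apply/xE/codom_f.
Qed.

Let swapK p q (x : injword n s) : swap p q (swap p q x) = x.
Proof. by apply/val_inj/ffunP => i; rewrite !swapE tpermK. Qed.

(** Off the words in [E] both sides vanish. A word in [E] misses exactly one letter of [E]; if that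
    is [a] or [b], the merge relation applies directly. *)
Let swap_sign a b (x : injword n s) :
  a \in E -> b \in E -> a != b -> w (swap a b x) = - w x.
Proof.
move=> aE bE ab.
have swapC y : swap a b y = swap b a y.
  by apply/val_inj/ffunP => i; rewrite !swapE tpermC.
have [xE|xNE] := boolP [forall i, val x i \in E]; last first.
  have -> : w x = 0.
    apply/eqP; apply: contraNT xNE => /w_codom xE; apply/forallP => i.
    by apply/xE/codom_f.
  rewrite oppr0; apply/eqP; apply: contraNT xNE => /w_codom xE.
  apply/forallP => i; rewrite -(swapK a b x); apply: (swap_codom aE bE xE).
  exact: codom_f.
have {}xE : {subset codom (val x) <= E}.
  by move=> _ /codomP[i ->]; move/forallP: xE; apply.
have ba : b != a by rewrite eq_sym.
have [bx|bx] := boolP (b \in codom (val x)); last first.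
  by rewrite swapC (merge_relation bE aE ba xE bx) opprK.
have [ax|ax] := boolP (a \in codom (val x)); last first.
  by rewrite (merge_relation aE bE ab xE ax) opprK.
have [p pE px] : exists2 p, p \in E & p \notin codom (val x).
  apply: contrapT => N; suff : (#|E| <= #|codom (val x)|)%N.
    by rewrite card_E card_injword ltnn.
  apply/subset_leq_card/fintype.subsetP => z zE; apply: contrapT => /negP zx.
  by apply: N; exists z.
have pa : p != a by apply: contraNneq px => ->.
have pb : p != b by apply: contraNneq px => ->.
have xp i : val x i != p by apply: contraNneq px => <-; apply: codom_f.
have notin_codom c (y : injword n s) :
    (forall i, val y i != c) -> c \notin codom (val y).
  by move=> yc; apply/codomP => -[i ci]; have := yc i; rewrite -ci eqxx.
have ya : a \notin codom (val (swap p a x)).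
  apply: notin_codom => i; rewrite swapE.
  by case: tpermP => [xip|_|_ /eqP] //; have := xp i; rewrite xip eqxx.
have zp : p \notin codom (val (swap a b x)).
  apply: notin_codom => i; rewrite swapE.
  by case: tpermP; rewrite eq_sym // => _ _; rewrite eq_sym.
(* Here the missing letter is [p]. Since [(p b)(a b) = (a b)(p a)], three merge relations suffice,
   each exchanging a missing letter with a present one. *)
rewrite (merge_relation pE bE pb (swap_codom aE bE xE) zp).
rewrite (merge_relation pE aE pa xE px) opprK.
rewrite (merge_relation aE bE ab (swap_codom pE aE xE) ya); congr (- w _).
apply/val_inj/ffunP => i; rewrite !swapE.
have [->|xa] := eqVneq (val x i) a.
  by rewrite tpermL !tpermR tpermD // eq_sym.
have [->|xb] := eqVneq (val x i) b.
  by rewrite tpermR [tperm p a b]tpermD // ?tpermR ?tpermD // eq_sym.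
by rewrite [tperm a b (val x i)]tpermD ?[tperm p a (val x i)]tpermD
  ?[tperm p b (val x i)]tpermD ?[tperm a b (val x i)]tpermD // eq_sym ?xp.
Qed.

(** [endo (tperm a b)] is [e] followed by the exchange of two letters, so the sign is read off on
    words from [swap_sign]. *)
Lemma embedded_sign (a b : 'I_s.+1) : a != b ->
  mbasis K (endo sn (tperm a b)) *: m = - (mbasis K e *: m).
Proof.
move=> ab; pose a' := widen_ord sn a; pose b' := widen_ord sn b.
have ab' : a' != b' by apply: contra_neq ab => /(congr1 val)/= ab; apply: val_inj.
have -> : endo sn (tperm a b) = (transf_tperm a' b' * e)%g.
  apply/ffunP => z; rewrite transfM !ffunE.
  have winj : injective (widen_ord sn).
    by move=> i k /(congr1 val)/= ik; apply: val_inj.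
  by rewrite -(inj_tperm _ _ _ winj).
have jN : j (- (mbasis K e *: m)) = - w by rewrite /w -linearZZ; apply: raddfN.
have jw : j (mbasis K e *: m) = w by rewrite linearZZ.
apply: j_inj; rewrite jN mbasisM -scalerA [j _]linearZZ jw.
apply/ffunP => x; transitivity (w (swap a' b' x)); last first.
  have oppE (u : D s W) y : (- u) y = - u y by rewrite ffunE.
  by rewrite swap_sign ?codom_f ?oppE.
rewrite pmod_basisE; apply: push1 => [|y /eqP]; first apply/eqP.
  by rewrite colp_actE; apply/eqP/ffunP => i; rewrite ffunE swapE ffunE tpermK.
rewrite colp_actE => /eqP/ffunP yx; apply/val_inj/ffunP => i.
by rewrite swapE -yx !ffunE tpermK.
Qed.

End EmbeddedSign.

(** * Projective dimensions *)

Section Dimension.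
Variables (K : numFieldType) (n : nat).
Local Notation T := (full_transf n).
Local Notation A := (monoid_algebra K T).
Local Notation D r M := (pmod (injword n r) M).
Implicit Types (s d : nat) (M W : lmodType A).

Lemma killed_top c M (m : M) : (n <= c)%N -> killed c M -> m = 0.
Proof.
move=> nc /(_ 1%g m) M0; rewrite -[m]scale1r -mbasis1 M0 //.
by rewrite /rank (leq_trans (max_card _)) // card_ord.
Qed.

Lemma killed_kerm_cover s (sn : (s < n)%N) M (Mk : killed s M) :
  killed s.+1 (kerm (cover sn Mk)).
Proof.
move=> g x gs; apply: kerm_val_inj; rewrite linearZZ linear0.
by apply: (@killed_cover_ker K n s sn M Mk) => //; apply: kerm_valP.
Qed.

Lemma kerm_cover_embedded s (sn : (s < n)%N) M (Mk : killed s M) :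
  exists j : {linear kerm (cover sn Mk) -> D s.+1 M}, injective j.
Proof.
exists (@inv_val K n s sn M \o kerm_val (cover sn Mk)).
by move=> x y /= /inv_val_inj/kerm_val_inj.
Qed.

Lemma cover_embedded_surj s (sn : (s < n)%N) M W (j : {linear M -> D s W})
    (Mk : killed s M) :
  injective j -> surjective_map (cover sn Mk).
Proof.
move=> ji m; apply: (embedded_generated ji (widen_ord sn ord0)
  (P := fun m => exists x, cover sn Mk x = m)).
- by exists 0; rewrite linear0.
- by move=> _ _ [x <-] [y <-]; exists (x - y); rewrite linearB.
- by move=> g gs; apply: cover_image.
Qed.

Lemma inv_mod_embedded_projective s (sn : (s < n)%N) M W
    (j : {linear M -> D s W}) :
  injective j -> killed s M -> projective (inv_mod sn M).
Proof.
move=> ji Mk; apply: projective_inv_mod => a b m ab.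
exact: (embedded_sign sn ji Mk).
Qed.

Lemma pd_le_embedded d s M W (j : {linear M -> D s W}) :
  (s + d.+1 = n)%N -> injective j -> killed s M -> pd_le d M.
Proof.
elim: d s M W j => [|d IHd] s M W j sdn ji Mk.
all: have sn : (s < n)%N by rewrite -sdn addnS ltnS leq_addr.
all: have Pp := inv_mod_embedded_projective (sn := sn) ji Mk.
all: have cs := cover_embedded_surj sn Mk ji.
all: have Kk := @killed_kerm_cover s sn M Mk.
  (* Here [s.+1 = n], so the kernel is killed by every map and vanishes: the cover is an
     isomorphism. *)
  apply: projective_retract Pp; apply: (retract_bij (f := cover sn Mk) _ _).2 => //.
  apply: raddf_inj => x /kerm_ex[y <-].
  by rewrite (killed_top y _ Kk) ?linear0 // -sdn addn1.
have [j' ji'] := kerm_cover_embedded sn Mk.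
apply: (pd_le_quotient (ses_kerm cs)); last exact: projective_pd_le.
by apply: IHd ji' Kk; rewrite addSn -addnS.
Qed.

(** The cokernel of the cover is killed by rank [s.+1] and falls under the induction. The image is
    the quotient of [inv_mod], of dimension at most [s], by an embedded kernel to which
    [pd_le_embedded] applies. *)
Lemma pd_le_killed d s M : (s + d = n)%N -> killed s M -> pd_le n.-1 M.
Proof.
elim: d s M => [|d IHd] s M sdn Mk.
  apply: projective_pd_le; apply: projective0 => m; apply: killed_top Mk.
  by rewrite -sdn addn0.
have sn : (s < n)%N by rewrite -sdn addnS ltnS leq_addr.
have sn1 : (s <= n.-1)%N by rewrite -ltnS (ltn_predK sn).
pose q := @cokerm_pi A _ _ (cover sn Mk).
have qs : ses (kerm_val q) q by apply: ses_kerm; apply: cokerm_pi_surj.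
apply: (pd_le_ext qs); last first.
  apply: (IHd s.+1); first by rewrite addSn -addnS.
  move=> g c gs; have [m <-] := cokerm_pi_surj c.
  by rewrite -[LHS]linearZZ; apply/cokerm_pi_eq0/cover_image.
(* The cover corestricted to its image, which is the kernel of [q]. *)
have [|c cE] := corestr (p := q) (h := cover sn Mk).
  by move=> x; apply/cokerm_pi_eq0; exists x.
have cs : surjective_map c.
  move=> y; have /cokerm_pi_eq0[x xE] := kerm_valP y.
  by exists x; apply: kerm_val_inj; rewrite cE.
have Pd : pd_le n.-1 (inv_mod sn M).
  have [r [_ rK]] := inv_retract sn M.
  apply: pd_le_trans sn1 _.
  have := @pd_le_colourings K n M s (complete s.+1) sn.
  apply: (@pd_le_retract K T s).
  by exists (@inv_val K n s sn M), r; apply: rK.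
have kc : ses (kerm_val (cover sn Mk)) c.
  split=> // [|x]; first exact: kerm_val_inj.
  split=> [cx|[y <-]].
    by apply: kerm_ex; rewrite -cE cx linear0.
  by apply: kerm_val_inj; rewrite cE kerm_valP linear0.
have Kk := @killed_kerm_cover s sn M Mk.
(* For [s.+1 = n] the kernel vanishes and the image is [inv_mod] itself; otherwise the kernel has
   dimension at most [n.-2]. *)
case: d sdn {IHd} => [|d] sdn.
  apply: pd_le_retract Pd; apply: (retract_bij (f := c) _ _).2 => //.
  apply: raddf_inj => x /(ses_exact kc)[y <-].
  by rewrite (killed_top y _ Kk) ?linear0 // -sdn addn1.
have [j' ji'] := kerm_cover_embedded sn Mk.
have dn : (d <= n.-2)%N by rewrite -sdn !addnS /= leq_addl.
have n2 : n.-1 = n.-2.+1 by rewrite -sdn !addnS.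
move: Pd; rewrite n2; apply: (pd_le_quotient kc).
apply: pd_le_trans dn _; apply: pd_le_embedded ji' Kk.
by rewrite -sdn !addnS.
Qed.

(** As [s.+1 < n], some letter [o] lies outside the standard word [y0]. Applying [alt] for the
    [s.+1] letters of [y0] to a [delta] at [y0] gives 0 in [M], but the coefficient at [y0]
    survives. *)
Lemma cover_kernel_neq0 s (sn : (s.+1 < n)%N) M W (j : {linear M -> D s W})
    (Mk : killed s M) (m : M) :
  injective j -> m != 0 ->
  exists x : inv_mod (ltnW sn) M, x != 0 /\ cover (ltnW sn) Mk x = 0.
Proof.
move=> ji m0; have sn' := ltnW sn.
have [g gs gm] : exists2 g : T, (rank g <= s.+1)%N & mbasis K g *: m != 0.
  apply: contrapT => N; case/eqP: m0.
  apply: (embedded_generated ji (Ordinal sn) (P := fun x => x = 0)) => //.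
    by move=> _ _ -> ->; rewrite subrr.
  by move=> g gs; apply/eqP; apply: contrapT => /negP gm; apply: N; exists g.
have [f [q gE]] := rank_factor (ltnW sn) gs.
pose u := mbasis K q *: m.
(* The coefficient must be nonzero in [e M], since averaging replaces [u] by a multiple of [e u] at
   [y0]. *)
have eu : mbasis K (endo (ltnW sn) id) *: u != 0.
  apply: contraNneq gm => eu.
  have -> : g = (extend f * endo (ltnW sn) id * q)%g.
    by rewrite extend_endo precomp_id.
  by rewrite !mbasisM -!scalerA eu scaler0.
have [r [rE rK]] := inv_retract (ltnW sn) M.
pose o : 'I_n := Ordinal sn.
pose y0 := iota (ltnW sn).
pose Y := [set val y0 i | i : 'I_s.+1].
have Yc : #|Y| = s.+1 by rewrite card_imset ?card_ord //; apply: injword_inj.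
pose x := alt K o Y *: r (delta y0 u).
exists x; split; last first.
  by rewrite linearZZ (alt_embedded0 ji) // Yc.
apply/eqP => /(congr1 (@inv_val K n s (ltnW sn) M))/ffunP/(_ y0).
rewrite linear0 linearZZ /= rE.
have oy i : val y0 i != o.
  by rewrite iotaE; apply/eqP => /(congr1 val)/=; apply/eqP; rewrite neq_ltn ltn_ord.
have yY i : val y0 i \in Y by apply: imset_f.
have kE (X : {set 'I_n}) (f' : {ffun 'I_s.+1 -> 'I_n}) i :
    postcomp (keep o X) f' i = if f' i \in X then f' i else o by rewrite !ffunE.
(* The values of [keep o X] on a word reaching [y0] must include all of [Y] without using [o], which
   forces [X = Y]. *)
have keepE (X : {set 'I_n}) (w : D s.+1 M) : X \subset Y ->
    (mbasis K (keep o X) *: w) y0 = if X == Y then w y0 else 0.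
  move=> XY; rewrite pmod_basisE; case: ifP => [/eqP->|XneY].
    apply: push1 => [|z /eqP]; first apply/eqP.
      rewrite colp_actE; apply/eqP/ffunP => i.
      by rewrite kE yY.
    rewrite colp_actE => /eqP/ffunP zE; apply/val_inj/ffunP => i.
    have := zE i; rewrite kE; case: ifP => // _ oE.
    by have := oy i; rewrite -oE eqxx.
  apply: push0 => z /eqP; rewrite colp_actE => /eqP/ffunP zE.
  case/negP: XneY; rewrite finset.eqEsubset XY.
  apply/fintype.subsetP => _ /imsetP[i _ ->].
  have := zE i; rewrite kE; case: ifP => [zX <- //|_ oE].
  by have := oy i; rewrite -oE eqxx.
rewrite /alt scaler_suml sum_ffunE (bigD1 Y) ?powersetE //= big1 ?addr0; last first.
  move=> X; rewrite powersetE => /andP[XY XneY].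
  by rewrite alg_scaleE [LHS]pmod_constE keepE // (negPf XneY) scaler0.
rewrite alg_scaleE [X in X = _ -> _]pmod_constE keepE // eqxx [avg _ _ y0]ffunE.
rewrite (bigD1 (1%g : 'S_s.+1)) //= permx1 big1 ?addr0; last first.
  move=> sg sg1; rewrite ffunE; case: eqP => [/(congr1 val)/ffunP sgE|]; last first.
    by rewrite scaler0.
  case/eqP: sg1; apply/permP => i; rewrite perm1.
  by have := sgE i; rewrite permxE => /injword_inj.
rewrite [X in mbasis _ _ *: X]ffunE eqxx alg_scaleA [X in _ = X -> _]ffunE.
move=> /eqP; apply/negP.
have -> : endo (ltnW sn) (1%g : 'S_s.+1) = endo (ltnW sn) id.
  by congr extend; apply/ffunP => i; rewrite !ffunE perm1.
apply: contra eu => /eqP c0.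
set k := (_ * _ : K) in c0.
have k0 : k != 0 by rewrite mulf_neq0 ?signr_eq0 ?invr_eq0 ?card_perm_neq0.
have := congr1 ( *:%R (k^-1%:A : A)) c0.
by rewrite scaler0 alg_scaleA mulVf // !scale1r => ->.
Qed.

(** Each step passes to the nonzero kernel of the projective cover. At [d = 0] projectivity of [M]
    would retract [inv_mod] onto that kernel, against [inv_mod_hom0]. *)
Lemma not_pd_le_embedded d s M W (j : {linear M -> D s W}) (m : M) :
  (s + d.+1 < n)%N -> injective j -> killed s M -> m != 0 -> ~ pd_le d M.
Proof.
elim: d s M W j m => [|d IHd] s M W j m sdn ji Mk m0 Md.
all: have sn : (s.+1 < n)%N by apply: leq_ltn_trans sdn; rewrite addnS ltnS leq_addr.
all: have cs := cover_embedded_surj (ltnW sn) Mk ji.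
all: have Kk := @killed_kerm_cover s (ltnW sn) M Mk.
all: have [x [x0 /kerm_ex[y yx]]] := cover_kernel_neq0 sn Mk ji m0.
all: have y0 : y != 0 by apply: contra_neq x0 => y0; rewrite -yx y0 linear0.
  have [r [_ [rK _]]] := ses_split (ses_kerm cs) Md.
  by case/eqP: y0; rewrite -(rK y) (inv_mod_hom0 r _ Kk).
have [j' ji'] := kerm_cover_embedded (ltnW sn) Mk.
apply: (IHd _ _ _ j' y _ ji' Kk y0); first by rewrite addSn -addnS.
apply: pd_le_sub (ses_kerm cs) _ Md.
exact: inv_mod_embedded_projective ji Mk.
Qed.

Lemma trivial_module_pd : (0 < n)%N ->
  exists M : lmodType A, forall d, pd_le d M -> (n.-1 <= d)%N.
Proof.
move=> n0; exists (D 0 A^o) => d Md; rewrite leqNgt; apply/negP => dn.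
have [x _] : exists x : injword n 0, True.
  have [|x _] := @injword_ex n 0 [ffun i => Ordinal n0]; last by exists x.
  by move=> [].
apply: (@not_pd_le_embedded d 0 (D 0 A^o) A^o idfun (delta x 1)) => //.
- by rewrite add0n -ltn_predRL.
- move=> g m; rewrite leqn0 => /eqP/card0_eq/(_ (g (Ordinal n0))).
  by rewrite codom_f.
- apply/eqP => /ffunP/(_ x); rewrite !ffunE eqxx.
  by apply/eqP/oner_neq0.
Qed.

End Dimension.

(** * The global dimension *)

Section GlobalDimension.
Variables (R : realType) (K : numFieldType) (n : nat).
Local Notation A := (monoid_algebra K (full_transf n)).
Implicit Types (d : nat) (M : lmodType A).

Lemma proj_dim_le d M : pd_le d M -> (proj_dim R M <= d%:R%:E)%E.
Proof.
by move=> /pd_le_resolution[X Xd]; apply: ereal_inf_lbound; exists d => //; exists X.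
Qed.

Lemma proj_dim_ge c M :
  (forall d, pd_le d M -> (c <= d)%N) -> (c%:R%:E <= proj_dim R M)%E.
Proof.
move=> cM; apply: le_ereal_inf_tmp => _ [d [X Xd] <-].
by rewrite lee_fin ler_nat; apply/cM/(resolution_pd_le Xd).
Qed.

Lemma global_dim_full_transf : (0 < n)%N -> global_dim R A = (n.-1%:R)%:E.
Proof.
move=> n0; apply/eqP; rewrite Order.POrderTheory.eq_le; apply/andP; split.
  apply: ge_ereal_sup => _ [M ->]; apply: proj_dim_le.
  (* The descent starts at [s = 0]: no map of a nonempty set has rank 0, so every module is killed
     by rank 0. *)
  apply: (@pd_le_killed K n n 0) => // g m; rewrite leqn0 => /eqP.
  by move=> /card0_eq/(_ (g (Ordinal n0))); rewrite codom_f.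
have [M Mn] := trivial_module_pd K n0.
apply: Order.POrderTheory.le_trans (proj_dim_ge Mn) _.
by apply: ereal_sup_ubound; exists M.
Qed.

End GlobalDimension.

Theorem theorem3p7 (R : realType) (n : nat) (hn : (1 <= n)%N) :
  global_dim R (monoid_algebra R[i] (full_transf n)) = ((n - 1)%N%:R)%:E.
Proof. by rewrite subn1; apply: (@global_dim_full_transf R R[i] n hn). Qed.
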